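(* Let $\lambda\in(0,1)$, $\tau=\min(\lambda,1-\lambda)$, $\varepsilon>0$, and let $h,f,g:\mathbb{R}\to\mathbb{R}_+$ be measurable functions satisfying $$(1)\quad h(\lambda x+(1-\lambda)y)\ge f(x)^{\lambda}g(y)^{1-\lambda}\qquad\text{for all }x,y\in\mathbb{R}.$$ Suppose also that either $h$ is log-concave, or both $f$ and $g$ are log-concave, and that $$(2)\quad \int_{\mathbb{R}} h\le(1+\varepsilon)\left(\int_{\mathbb{R}} f\right)^{\lambda}\left(\int_{\mathbb{R}} g\right)^{1-\lambda}.$$ Then there exist $C,a>0$, $x_0\in\mathbb{R}$, and a log-concave function $\tilde h:\mathbb{R}\to\mathbb{R}_+$ such that $$(3)\quad\begin{cases}\displaystyle\int_{\mathbb{R}}\left|f(x)-a^{-\lambda}\tilde h(x+\lambda x_0)\right|dx\le C\left(\frac{\varepsilon}{\tau}\right)^{1/2}\int_{\mathbb{R}}f(x)\,dx,\\[2mm] \displaystyle\int_{\mathbb{R}}\left|g(x)-a^{1-\lambda}\tilde h(x-(1-\lambda)x_0)\right|dx\le C\left(\frac{\varepsilon}{\tau}\right)^{1/2}\int_{\mathbb{R}}g(x)\,dx,\\[2mm] \displaystyle\int_{\mathbb{R}}|h(x)-\tilde h(x)|\,dx\le C\left(\frac{\varepsilon}{\tau}\right)^{1/2}\int_{\mathbb{R}}h(x)\,dx.\end{cases}$$ This result is sharp, in the sense that there are functions $h,f,g$ satisfying (1) and (2) for which (3) is reversed (with a smaller constant $C$).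
   Context: $\mathbb{R}_+$ denotes the non-negative reals. A function $\varphi:\mathbb{R}\to\mathbb{R}_+$ is log-concave if $\varphi(sx+(1-s)y)\ge\varphi(x)^{s}\varphi(y)^{1-s}$ for all $x,y\in\mathbb{R}$ and $s\in(0,1)$.
   Formalization: In (3) the exponents and shifts of f and g are corrected to a^{-(1-λ)}h̃(x+(1-λ)x₀) and a^{λ}h̃(x-λx₀), since the printed ones fail for λ≠1/2 with absolute C; the integrals of f and g are assumed positive and finite, since the claim fails otherwise. *)

(* Defs.v *)
From mathcomp Require Import all_boot all_order all_algebra.
From mathcomp Require Import all_classical all_reals all_analysis.
Set Implicit Arguments.
Unset Strict Implicit.
Unset Printing Implicit Defensive.
Import Order.TTheory GRing.Theory Num.Theory.
Import numFieldNormedType.Exports.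
Local Open Scope classical_set_scope.
Local Open Scope ring_scope.

(* Lebesgue measurability: the domain carries the Caratheodory (Lebesgue)
   sigma-algebra, on which completed_lebesgue_measure is defined; the codomain
   carries the Borel sigma-algebra. *)
Definition lebesgue_measurable (R : realType) (f : R -> R) : Prop :=
  measurable_fun [set: caratheodory_type ((wlength (R := R) idfun)^*)%mu] f.

Definition lebesgue_integral (R : realType) (f : R -> R) : \bar R :=
  (\int[@completed_lebesgue_measure R]_x (f x)%:E)%E.

(* The codomain R_+ is part of the definition. *)
Definition log_concave (R : realType) (phi : R -> R) : Prop :=
  (forall x, 0 <= phi x) /\
  (forall x y s, 0 < s < 1 ->
     phi x `^ s * phi y `^ (1 - s) <= phi (s * x + (1 - s) * y)).

(* Integrals of f and g are positive and finite so that the last clause, an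
   inequality in the extended reals, is a genuine constraint on f, g and h.
   Otherwise it holds, for instance, when f = h = 0 and g is any integrable
   function, or when f = h = 1 and g is any integrable function with values
   in [0, 1]. *)
Definition prekopa_leindler_near_equality (R : realType) (lam eps : R)
    (f g h : R -> R) : Prop :=
  [/\ [/\ forall x, 0 <= f x, forall x, 0 <= g x & forall x, 0 <= h x],
      [/\ lebesgue_measurable f, lebesgue_measurable g
        & lebesgue_measurable h],
      (0 < lebesgue_integral f < +oo)%E /\ (0 < lebesgue_integral g < +oo)%E,
      forall x y,
        f x `^ lam * g y `^ (1 - lam) <= h (lam * x + (1 - lam) * y)
    & (lebesgue_integral h <=
        (1 + eps)%:E * (lebesgue_integral f `^ lam *
                        lebesgue_integral g `^ (1 - lam)))%E].

(* Main.v *)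
(* Normalise int f = int g = 1 and put t = min(lam, 1 - lam), d = sqrt(eps / t);
   if eps >= t take ht = 0. If f and g are log-concave, h may be replaced by
   their sup-convolution, which is log-concave and below h, so ht is h or this
   sup-convolution.

   Only unimodality of h is used from here on. Starting from a mode z0 of h,
   choose points x_i, y_i with equal mass of f before x_i and of g before y_i,
   such that lam x_i + (1 - lam) y_i = z0 + i eta. Let p, q be the lengths of the
   i-th x- and y-cell, n their common mass and M the supremum of h on the i-th
   z-cell. Then n <= M p^lam q^(1 - lam) <= eta M, and summing over i shows that
   the total loss is at most eps, up to discretisation errors.
   The refined weighted AM-GM inequality
     lam p + (1 - lam) q - p^lam q^(1 - lam) >= t (sqrt p - sqrt q)^2
   turns this into sum M |p - eta| = O(d), so the x-cells differ little from the
   z-cells in the L1 sense weighted by h. As h is monotone on either side of z0,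
   moving its values from the z-cells to the x-cells costs at most that sum, and
   on each x-cell f is bounded by a constant with almost the same integral.
   Hence f, and symmetrically g, is O(d)-close to a translate of h, and the two
   translations differ by a common x0 because lam x_0 + (1 - lam) y_0 = z0.

   For sharpness, f and g are normalised indicators of intervals of lengths 1 and
   1 + d: their Prekopa-Leindler deficit is at most lam (1 - lam) d^2 <= eps,
   while no function is, after the permitted scalings and translations, within
   d / 10 of both. *)
Require Import Defs.
From mathcomp Require Import all_boot all_order all_algebra.
From mathcomp Require Import all_classical all_reals all_analysis.
From mathcomp Require Import measurable_realfun ring lra.
Import Order.TTheory GRing.Theory Num.Theory.
Import numFieldNormedType.Exports.
Local Open Scope classical_set_scope.
Local Open Scope ring_scope.

(** * Lebesgue and Borel measurability *)

Notation lebT R := (caratheodory_type ((wlength (R := R) idfun)^*)%mu).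

Lemma borel_lebesgue_measurable_set {R : realType} (A : set R) :
  measurable (A : set (measurableTypeR R)) -> measurable (A : set (lebT R)).
Proof. exact: sub_caratheodory. Qed.

Lemma measurable_id_lebT {R : realType} :
  measurable_fun [set: lebT R] (id : lebT R -> measurableTypeR R).
Proof.
by move=> _ A mA; rewrite setTI; exact: borel_lebesgue_measurable_set.
Qed.

Lemma borel_lebesgue_measurable {R : realType} (f : R -> R) :
  measurable_fun [set: measurableTypeR R] f -> lebesgue_measurable f.
Proof.
by move=> mf; apply: (measurableT_comp mf); exact: measurable_id_lebT.
Qed.

(** The identity from the Lebesgue to the Borel sigma-algebra pushes the completed measure forward
    to [lebesgue_measure]; this is change of variables along it. *)
Lemma lebesgue_integral_borel {R : realType} (f : R -> R) :
  measurable_fun [set: measurableTypeR R] f -> (forall x, 0 <= f x) ->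
  lebesgue_integral f = (\int[@lebesgue_measure R]_x (f x)%:E)%E.
Proof.
move=> mf f0; rewrite /lebesgue_integral.
rewrite -[LHS](@ge0_integral_pushforward _ _ (lebT R) (measurableTypeR R) R
  _ (@measurable_id_lebT R) (@completed_lebesgue_measure R) setT (EFin \o f))//.
- by apply/measurable_EFinP.
- by move=> y _; rewrite lee_fin.
Qed.

(** The translate of Lebesgue measure agrees with it on half-open intervals, hence everywhere by
    uniqueness. It is applied to quasi-concave functions and to Borel expressions in them. *)
Lemma lebesgue_integral_shift {R : realType} (f : R -> R) (c : R) :
  measurable_fun [set: measurableTypeR R] f -> (forall x, 0 <= f x) ->
  lebesgue_integral (fun x => f (x + c)) = lebesgue_integral f.
Proof.
move=> mf f0.
have ms : measurable_fun [set: measurableTypeR R]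
    ((fun x => x + c) : measurableTypeR R -> measurableTypeR R).
  exact: measurable_funD.
rewrite !lebesgue_integral_borel//; last exact: measurableT_comp.
rewrite -[LHS](@ge0_integral_pushforward _ _ _ _ R
  _ ms (@lebesgue_measure R) setT (EFin \o f))//; last 2 first.
- by apply/measurable_EFinP.
- by move=> y _; rewrite lee_fin.
apply: eq_measure_integral => A mA _; apply/esym.
apply: lebesgue_measure_unique => //= _ [[a b]] _ <-.
rewrite /pushforward /=.
have -> : (fun x => x + c) @^-1` `]a, b] = `](a - c), (b - c)]%classic.
  apply/seteqP; split => x /=; rewrite !in_itv/= => /andP[? ?]; apply/andP; split; lra.
rewrite !lebesgue_measure_itv/= !lte_fin ltrD2r; case: ifPn => // _.
by rewrite -!EFinB; congr (_ %:E); lra.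
Qed.

Definition quasi_concave {R : realType} (h : R -> R) :=
  forall x y z, x <= y <= z -> Num.min (h x) (h z) <= h y.

(** Strict superlevel sets are intervals, and these generate the Borel structure on the values. *)
Lemma quasi_concave_measurable {R : realType} (h : R -> R) :
  quasi_concave h -> measurable_fun [set: measurableTypeR R] h.
Proof.
move=> qh mT; apply: (measurability _ (RGenOInfty.measurableE R)) => //.
move=> _ [_ [a -> <-]]; rewrite setTI; apply: is_interval_measurable.
move=> x y /=; rewrite !in_itv/= !andbT => ax ay z xyz.
by rewrite in_itv/= andbT; apply: lt_le_trans (qh _ _ _ xyz); rewrite lt_min ax.
Qed.

Lemma quasi_concave_shift {R : realType} (h : R -> R) c :
  quasi_concave h -> quasi_concave (fun x => h (x + c)).
Proof. by move=> qh x y z xyz; apply: qh; lra. Qed.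

(** A weighted geometric mean is at least the minimum [m], because [m = m^s m^(1-s)]. *)
Lemma log_concave_quasi {R : realType} (h : R -> R) :
  log_concave h -> quasi_concave h.
Proof.
move=> [h0 lh] x y z /andP[xy yz].
have [->|xy'] := eqVneq x y; first by rewrite ge_min lexx.
have [->|yz'] := eqVneq y z; first by rewrite ge_min lexx orbT.
have {xy' xy} xy : x < y by rewrite lt_neqAle xy'.
have {yz' yz} yz : y < z by rewrite lt_neqAle yz'.
set s := (z - y) / (z - x).
have s0 : 0 < s by rewrite divr_gt0//; lra.
have s1 : s < 1 by rewrite ltr_pdivrMr; lra.
have s01 : 0 < s < 1 by rewrite s0.
have -> : y = s * x + (1 - s) * z by rewrite /s; field; lra.
apply: le_trans (lh x z s s01).
set m := Num.min _ _.
have m0 : 0 <= m by rewrite le_min !h0.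
have [->|mn0] := eqVneq m 0; first by rewrite mulr_ge0// powR_ge0.
have -> : m = m `^ s * m `^ (1 - s).
  rewrite -powRD; first by rewrite [s + _]addrC subrK powRr1.
  by rewrite mn0 implybT.
apply: ler_pM; rewrite ?powR_ge0//; apply: ge0_ler_powR; rewrite ?nnegrE//; try lra.
- by rewrite ge_min lexx.
- by rewrite ge_min lexx orbT.
Qed.

(** * Refined arithmetic-geometric mean inequalities *)

(** Young's inequality for [p^l] and [q^m] with conjugate exponents [1/l] and [1/m]. *)
Lemma weighted_am_gm {R : realType} (l m p q : R) :
  0 < l -> 0 < m -> l + m = 1 -> 0 <= p -> 0 <= q ->
  p `^ l * q `^ m <= l * p + m * q.
Proof.
move=> l0 m0 lm p0 q0.
have := @conjugate_powR R (p `^ l) (q `^ m) l^-1 m^-1.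
rewrite !powR_ge0 !invr_gt0 l0 m0 !invrK lm => /(_ isT isT isT isT erefl).
by rewrite -!powRrM !divff ?gt_eqF// !powRr1// [p * _]mulrC [q * _]mulrC.
Qed.

(* l p + m q - l (sqrt p - sqrt q)^2 = 2 l sqrt(p q) + (m - l) q is itself a
   weighted mean, whose geometric mean is p^l q^m. *)
Lemma weighted_am_gm_deficit_half {R : realType} (l m p q : R) :
  0 < l -> 0 < m -> l + m = 1 -> l <= m -> 0 <= p -> 0 <= q ->
  l * (Num.sqrt p - Num.sqrt q) ^+ 2 <= l * p + m * q - p `^ l * q `^ m.
Proof.
move=> l0 m0 lm lem p0 q0.
have [sp sq] : 0 <= Num.sqrt p /\ 0 <= Num.sqrt q by rewrite !sqrtr_ge0.
have sqrtE (x : R) a : 0 <= x -> x `^ a = Num.sqrt x `^ (2 * a).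
  by move=> x0; rewrite powRrM powR_mulrn ?sqrtr_ge0// sqr_sqrtr.
have pE := sqr_sqrtr p0; have qE := sqr_sqrtr q0.
suff : p `^ l * q `^ m <= 2 * l * (Num.sqrt p * Num.sqrt q) + (m - l) * q.
  move=> H; rewrite sqrrB pE qE; lra.
(* The weights [2 l] and [m - l] are both positive only if [l < m]; for [l = m = 1/2] the bound is
   an equality. *)
have [lem'|] := ltP l m; last first.
  move=> mlel; have -> : m = l by lra.
  have -> : l = 2^-1 by lra.
  rewrite !powR12_sqrt// subrr mul0r addr0 mulfV// ?mul1r// pnatr_eq0//.
have := @weighted_am_gm R (2 * l) (m - l) (Num.sqrt p * Num.sqrt q) q.
rewrite powRM// -!sqrtE// -mulrA.
have [->|qn0] := eqVneq q 0.
  by move=> _; rewrite powR0 ?gt_eqF// mulr0 sqrtr0 !mulr0 addr0.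
rewrite -powRD ?qn0 ?implybT// [l + _]addrC subrK; apply; try lra.
by rewrite mulr_ge0.
Qed.

Lemma weighted_am_gm_deficit {R : realType} (l m t p q : R) :
  0 < l -> 0 < m -> l + m = 1 -> t <= l -> t <= m -> 0 <= p -> 0 <= q ->
  t * (Num.sqrt p - Num.sqrt q) ^+ 2 <= l * p + m * q - p `^ l * q `^ m.
Proof.
move=> l0 m0 lm tl tm p0 q0; set d := _ ^+ 2.
have d0 : 0 <= d by exact: sqr_ge0.
have [lem|mlel] := leP l m.
- apply: le_trans (weighted_am_gm_deficit_half _ _ _ _ _ _ _ _ _ _) => //.
  by rewrite ler_wpM2r.
- have := @weighted_am_gm_deficit_half R m l q p m0 l0.
  rewrite addrC => /(_ lm (ltW mlel) q0 p0).
  rewrite -sqrrN opprB [_ * q + _]addrC [q `^ _ * _]mulrC -/d; apply: le_trans.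
  by rewrite ler_wpM2r.
Qed.

(** Write [|p - q| = 2 c e + e^2], where [c] is the smaller and [c + e] the larger of the two square
    roots. Then [c^2 <= eta], the refined AM-GM inequality bounds [e^2], and
    [2 c e <= d c^2 + e^2 / d]. The parameter [d] stays free; it is chosen after summing over all
    cells. *)
Lemma dist_le_deficit {R : realType} (l m t d eta p q : R) :
  0 < l -> 0 < m -> l + m = 1 -> 0 < t -> t <= l -> t <= m ->
  0 < d -> d <= 1 -> 0 <= p -> 0 <= q -> l * p + m * q = eta ->
  `|p - q| <= d * eta + 2 * (eta - p `^ l * q `^ m) / (t * d).
Proof.
move=> l0 m0 lm t0 tl tm d0 d1 p0 q0 etaE.
have := @weighted_am_gm_deficit R l m t p q l0 m0 lm tl tm p0 q0.
rewrite etaE; move: (eta - _) => D.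
set a := Num.sqrt p; set b := Num.sqrt q => tD.
have [a0 b0] : 0 <= a /\ 0 <= b by rewrite !sqrtr_ge0.
have pE : p = a ^+ 2 by rewrite sqr_sqrtr.
have qE : q = b ^+ 2 by rewrite sqr_sqrtr.
have abE : (a - b) ^+ 2 <= D / t by rewrite ler_pdivlMr// mulrC.
have -> : 2 * D / (t * d) = 2 * (D / t) / d by field; rewrite !gt_eqF.
suff H : `|p - q| <= d * eta + 2 * (a - b) ^+ 2 / d.
  by apply: le_trans H _; rewrite lerD2l ler_pM2r ?invr_gt0//; lra.
have key c e : 0 <= c -> 0 <= e -> c ^+ 2 <= eta ->
    (c + e) ^+ 2 - c ^+ 2 <= d * eta + 2 * e ^+ 2 / d.
  move=> c0 e0 ce.
  have -> : (c + e) ^+ 2 - c ^+ 2 = 2 * c * e + e ^+ 2 by ring.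
  have A : 2 * c * e <= d * c ^+ 2 + e ^+ 2 / d.
    rewrite -subr_ge0.
    have -> : d * c ^+ 2 + e ^+ 2 / d - 2 * c * e = d * (c - e / d) ^+ 2.
      by field; lra.
    by rewrite mulr_ge0 ?sqr_ge0// ltW.
  have B : e ^+ 2 <= e ^+ 2 / d.
    rewrite ler_pdivlMr//; have := sqr_ge0 e; nra.
  have : d * c ^+ 2 <= d * eta by rewrite ler_pM2l.
  have -> : 2 * e ^+ 2 / d = e ^+ 2 / d + e ^+ 2 / d by field; lra.
  lra.
have [ab|ba] := leP a b.
- have : p <= eta.
    rewrite -etaE; have : p <= q by rewrite pE qE ler_sqr.
    have lE : l = 1 - m by lra.
    by rewrite lE; nra.
  rewrite pE => /(key a (b - a) a0); rewrite subr_ge0 => /(_ ab).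
  have -> : a + (b - a) = b by ring.
  rewrite -[(b - a) ^+ 2]sqrrN opprB -pE -qE => H.
  by rewrite distrC ger0_norm// subr_ge0 pE qE ler_sqr.
- have : q <= eta.
    rewrite -etaE; have : q <= p by rewrite pE qE ler_sqr// ltW.
    have mE : m = 1 - l by lra.
    by rewrite mE; nra.
  rewrite qE => /(key b (a - b) b0); rewrite subr_ge0 => /(_ (ltW ba)).
  have -> : b + (a - b) = a by ring.
  rewrite -pE -qE => H.
  by rewrite ger0_norm// subr_ge0 pE qE ler_sqr// ltW.
Qed.

(** The hypothesis only gives [u <= (1 + t)^(1/l)], which is not linear in [t], hence the truncation
    at 1. For the truncated excess [w], multiplying [(1 + w)^l <= 1 + t] by
    [(1 + w)^(1-l) <= 1 + (1 - l) w] leaves [l w <= t (1 + (1 - l) w) <= 2 t]. *)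
Lemma min1_le_of_powR_le {R : realType} (l u t : R) :
  0 < l -> l < 1 -> 0 <= u -> u `^ l <= 1 + t -> 0 <= t ->
  Num.min 1 (u - 1) <= 2 * t / l.
Proof.
move=> l0 l1 u0 ut t0.
have t2 : 0 <= 2 * t / l by apply: divr_ge0; [exact: mulr_ge0|exact: ltW].
have [u1|u1] := leP u 1.
  by rewrite ge_min; apply/orP; right; apply: le_trans t2; lra.
set w := Num.min 1 (u - 1).
have w0 : 0 < w by rewrite lt_min; lra.
have w1 : w <= 1 by rewrite ge_min lexx.
have wu : w <= u - 1 by rewrite ge_min lexx orbT.
have H1 : (1 + w) `^ l <= 1 + t.
  apply: le_trans ut; apply: ge0_ler_powR; rewrite ?nnegrE//; lra.
have H2 : (1 + w) `^ (1 - l) <= 1 + (1 - l) * w.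
  have := @weighted_am_gm R (1 - l) l (1 + w) 1.
  by rewrite powR1 mulr1 => /(_ _ _ _ _ _) H; apply: le_trans (H _ _ _ _ _) _; lra.
have H3 : (1 + w) `^ l * (1 + w) `^ (1 - l) = 1 + w.
  rewrite -powRD; last by apply/implyP => _; lra.
  by rewrite [l + _]addrC subrK powRr1//; lra.
have H4 : 1 + w <= (1 + t) * (1 + (1 - l) * w).
  by rewrite -{1}H3; apply: ler_pM; rewrite ?powR_ge0.
rewrite ler_pdivlMr//; nra.
Qed.

(** * Integrals over half-open cells *)

(** For [A = setT] this is convertible to [lebesgue_integral f], and later proofs switch between the
    two by folding. *)
Definition lint {R : realType} (A : set R) (f : R -> R) : \bar R :=
  (\int[@completed_lebesgue_measure R]_(x in (A : set (lebT R))) (f x)%:E)%E.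

Definition lset {R : realType} (A : set R) : Prop :=
  measurable (A : set (lebT R)).

Lemma is_interval_lset {R : realType} (A : set R) : is_interval A -> lset A.
Proof.
move=> iA; apply: borel_lebesgue_measurable_set.
exact: is_interval_measurable.
Qed.

Lemma lset_setT {R : realType} : lset [set: R].
Proof. exact: measurableT. Qed.

Lemma lint_ge0 {R : realType} (A : set R) (f : R -> R) :
  (forall x, A x -> 0 <= f x) -> (0 <= lint A f)%E.
Proof. by move=> f0; apply: integral_ge0 => x Ax; rewrite lee_fin f0. Qed.

Lemma lebesgue_measurable_EFin {R : realType} (A : set R) (f : R -> R) :
  lebesgue_measurable f ->
  measurable_fun (A : set (lebT R)) (fun x => (f x)%:E).
Proof. by move=> mf; apply/measurable_EFinP; exact: measurable_funTS. Qed.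

Lemma lint_le {R : realType} (A : set R) (f g : R -> R) :
  lset A -> lebesgue_measurable f -> lebesgue_measurable g ->
  (forall x, A x -> 0 <= f x) -> (forall x, A x -> f x <= g x) ->
  (lint A f <= lint A g)%E.
Proof.
move=> mA mf mg f0 fg; apply: ge0_le_integral.
- exact: mA.
- by move=> x Ax; rewrite lee_fin f0.
- exact: lebesgue_measurable_EFin.
- exact: lebesgue_measurable_EFin.
- by move=> x Ax; rewrite lee_fin fg.
Qed.

Lemma eq_lint {R : realType} (A : set R) (f g : R -> R) :
  (forall x, A x -> f x = g x) -> lint A f = lint A g.
Proof. by move=> fg; apply: eq_integral => x /[!inE] Ax; rewrite fg. Qed.

Lemma lintD {R : realType} (A : set R) (f g : R -> R) :
  lset A -> lebesgue_measurable f -> lebesgue_measurable g ->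
  (forall x, A x -> 0 <= f x) -> (forall x, A x -> 0 <= g x) ->
  lint A (fun x => f x + g x) = (lint A f + lint A g)%E.
Proof.
move=> mA mf mg f0 g0; rewrite /lint.
under eq_integral do rewrite EFinD.
apply: ge0_integralD.
- exact: mA.
- by move=> x Ax; rewrite lee_fin f0.
- exact: lebesgue_measurable_EFin.
- by move=> x Ax; rewrite lee_fin g0.
- exact: lebesgue_measurable_EFin.
Qed.

Lemma lintZ {R : realType} (A : set R) (k : R) (f : R -> R) :
  lset A -> lebesgue_measurable f -> (forall x, A x -> 0 <= f x) -> 0 <= k ->
  lint A (fun x => k * f x) = (k%:E * lint A f)%E.
Proof.
move=> mA mf f0 k0; rewrite /lint.
under eq_integral do rewrite EFinM.
apply: ge0_integralZl_EFin.
- exact: mA.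
- by move=> x Ax; rewrite lee_fin f0.
- exact: lebesgue_measurable_EFin.
- exact: k0.
Qed.

Lemma lintU {R : realType} (A B : set R) (f : R -> R) :
  lset A -> lset B -> lebesgue_measurable f ->
  (forall x, (A `|` B) x -> 0 <= f x) -> (forall x, A x -> ~ B x) ->
  lint (A `|` B) f = (lint A f + lint B f)%E.
Proof.
move=> mA mB mf f0 AB; apply: ge0_integral_setU.
- exact: mA.
- exact: mB.
- exact: lebesgue_measurable_EFin.
- by move=> x ABx; rewrite lee_fin f0.
- by rewrite disj_set2E; apply/eqP; rewrite -subset0 => x [/AB].
Qed.

Lemma lint_subset {R : realType} (A B : set R) (f : R -> R) :
  lset A -> lset B -> lebesgue_measurable f ->
  (forall x, B x -> 0 <= f x) -> A `<=` B -> (lint A f <= lint B f)%E.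
Proof.
move=> mA mB mf f0 AB; apply: ge0_subset_integral.
- exact: mA.
- exact: mB.
- exact: lebesgue_measurable_EFin.
- by move=> x Bx; rewrite lee_fin f0.
- exact: AB.
Qed.

Lemma lint_cst {R : realType} (A : set R) (r : R) :
  lset A ->
  lint A (fun=> r) = (r%:E * @completed_lebesgue_measure R A)%E.
Proof. by move=> mA; exact: integral_cst. Qed.

Lemma lint0 {R : realType} (A : set R) : lint A (fun=> 0) = 0%E.
Proof. exact: integral0. Qed.

Lemma lint_null {R : realType} (A : set R) (f : R -> R) :
  lset A -> lebesgue_measurable f -> @completed_lebesgue_measure R A = 0%E ->
  lint A f = 0%E.
Proof.
by move=> mA mf A0; apply: null_set_integral;
  [exact: mA|exact: lebesgue_measurable_EFin|exact: A0].
Qed.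

Lemma completed_lebesgue_measure_itv {R : realType} (i : interval R) :
  @completed_lebesgue_measure R [set` i] =
  (if (i.1 < i.2)%E then (i.2 : \bar R) - i.1 else 0)%E.
Proof. exact: lebesgue_measure_itv. Qed.

Section LebesgueMeasurable.
Context {R : realType}.
Implicit Types f g : R -> R.

Lemma lebesgue_measurable_cst (c : R) : lebesgue_measurable (fun=> c).
Proof. exact: measurable_cst. Qed.

Lemma lebesgue_measurableD f g : lebesgue_measurable f ->
  lebesgue_measurable g -> lebesgue_measurable (fun x => f x + g x).
Proof. exact: measurable_funD. Qed.

Lemma lebesgue_measurableB f g : lebesgue_measurable f ->
  lebesgue_measurable g -> lebesgue_measurable (fun x => f x - g x).
Proof. exact: measurable_funB. Qed.

Lemma lebesgue_measurableZ (k : R) f : lebesgue_measurable f ->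
  lebesgue_measurable (fun x => k * f x).
Proof. by move=> mf; apply: measurable_funM => //; exact: measurable_cst. Qed.

Lemma lebesgue_measurable_pos f : lebesgue_measurable f ->
  lebesgue_measurable (fun x => Num.max 0 (f x)).
Proof. by move=> mf; apply: measurable_maxr => //; exact: measurable_cst. Qed.

Lemma lebesgue_measurable_norm f : lebesgue_measurable f ->
  lebesgue_measurable (fun x => `|f x|).
Proof. by move=> mf; apply: measurableT_comp => //. Qed.

End LebesgueMeasurable.
#[local] Hint Resolve lebesgue_measurable_cst : core.

(** For [s = 1] or [s = -1], the points on the right or left of [x0] at distance in []a, b]]. The
    sign lets one argument treat both sides of the mode. *)
Definition cell {R : realType} (s x0 a b : R) : set R :=
  [set x | a < s * (x - x0) <= b].

Lemma cell_lset {R : realType} (s x0 a b : R) : lset (cell s x0 a b).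
Proof.
apply: is_interval_lset => x y /= ; rewrite /cell/=.
move=> /andP[? ?] /andP[? ?] z /andP[? ?]; apply/andP.
have [s0|s0] := leP 0 s; split; nra.
Qed.
#[local] Hint Resolve cell_lset : core.

Lemma cell_measure {R : realType} (s x0 a b : R) :
  s = 1 \/ s = -1 -> a <= b ->
  @completed_lebesgue_measure R (cell s x0 a b) = (b - a)%:E.
Proof.
move=> [->|->] ab.
- have -> : cell 1 x0 a b = [set` `]x0 + a, x0 + b]].
    by apply/seteqP; split => x; rewrite /cell/= in_itv/= => /andP[? ?];
      apply/andP; split; lra.
  rewrite completed_lebesgue_measure_itv/= lte_fin; case: ifPn => ?.
    by rewrite -EFinB; congr (_%:E); lra.
  by congr (_%:E); lra.
- have -> : cell (-1) x0 a b = [set` `[x0 - b, x0 - a[].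
    by apply/seteqP; split => x; rewrite /cell/= in_itv/= => /andP[? ?];
      apply/andP; split; lra.
  rewrite completed_lebesgue_measure_itv/= lte_fin; case: ifPn => ?.
    by rewrite -EFinB; congr (_%:E); lra.
  by congr (_%:E); lra.
Qed.

Lemma lint_cell_split {R : realType} (s x0 a b c : R) (f : R -> R) :
  lebesgue_measurable f -> (forall x, 0 <= f x) -> a <= b -> b <= c ->
  lint (cell s x0 a c) f = (lint (cell s x0 a b) f + lint (cell s x0 b c) f)%E.
Proof.
move=> mf f0 ab bc; rewrite -lintU//.
- congr lint; apply/seteqP; split => x; rewrite /cell/=.
    by move=> /andP[? ?]; case: (leP (s * (x - x0)) b) => ?; [left|right];
      apply/andP; split.
  by move=> [|] /andP[? ?]; apply/andP; split; lra.
- by move=> x; rewrite /cell/= => /andP[? ?] /andP[? ?]; lra.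
Qed.

Lemma lint_cell_sum {R : realType} (s x0 : R) (a : nat -> R) (f : R -> R) n :
  lebesgue_measurable f -> (forall x, 0 <= f x) ->
  (forall i, a i <= a i.+1) ->
  (\sum_(i < n) lint (cell s x0 (a i) (a i.+1)) f)%E =
  lint (cell s x0 (a 0%N) (a n)) f.
Proof.
move=> mf f0 a_nd; elim: n => [|n IH].
  rewrite big_ord0; suff -> : cell s x0 (a 0%N) (a 0%N) = set0.
    by rewrite /lint integral_set0.
  by rewrite -subset0 => x; rewrite /cell/= => /andP[? ?]; lra.
rewrite big_ord_recr/= IH -lint_cell_split//.
by elim: n {IH} => // n IH; apply: le_trans IH _.
Qed.

Lemma lint_cell_le {R : realType} (s x0 c b w : R) (f : R -> R) :
  s = 1 \/ s = -1 -> lebesgue_measurable f -> (forall x, 0 <= f x <= w) ->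
  0 <= b -> 0 <= c -> (forall x, 0 < s * (x - x0) <= c -> f x = 0) ->
  (lint (cell s x0 0 b) f <= (w * Num.max 0 (b - c))%:E)%E.
Proof.
move=> s1 mf fw b0 c0 fc.
have f0 x : 0 <= f x by case/andP: (fw x).
have [bc|cb] := leP b c.
  rewrite (@eq_lint _ _ _ (fun=> 0)) ?lint0.
    by rewrite (_ : Num.max _ _ = 0) ?mulr0//; apply: max_l; lra.
  by move=> x; rewrite /cell/= => /andP[? ?]; apply: fc; apply/andP; split; lra.
rewrite (_ : Num.max _ _ = b - c); last by apply: max_r; lra.
rewrite (@lint_cell_split _ _ _ _ c)//; last exact: ltW.
rewrite [X in (X + _)%E](@eq_lint _ _ _ (fun=> 0)) ?lint0 ?add0e//.
apply: (@le_trans _ _ (lint (cell s x0 c b) (fun=> w))).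
  by apply: lint_le => // x _; case/andP: (fw x).
by rewrite lint_cst// cell_measure// ltW.
Qed.

(* Discrete layer cake: H = M i on the i-th cell of the partition a, while k >= M i
   on the first i cells of a regular partition of step eta. Subtracting the lowest
   level from H and truncating k there removes one cell. *)
Lemma lint_step_excess {R : realType} (s x0 eta : R) (k : R -> R)
    (M a : nat -> R) n :
  s = 1 \/ s = -1 -> lebesgue_measurable k -> 0 <= eta ->
  (forall x, 0 <= k x) -> a 0%N = 0 -> (forall i, a i <= a i.+1) ->
  (forall i, (i <= n)%N -> 0 <= M i) -> (forall i, M i.+1 <= M i) ->
  (forall i x, (i <= n)%N -> 0 < s * (x - x0) <= i%:R * eta -> M i <= k x) ->
  (\sum_(i < n.+1)
     lint (cell s x0 (a i) (a i.+1)) (fun x => Num.max 0 (M i - k x))%R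
   <= (\sum_(i < n.+1) M i * Num.max 0 (a i.+1 - a i - eta) + eta * M 0%N)%:E)%E.
Proof.
move=> s1 + eta0 + a0 a_nd + +.
have a_ge0 i : 0 <= a i by elim: i => [|i IH]; rewrite ?a0//; apply: le_trans IH _.
elim: n M k => [|n IH] M k mk k0 M0 M_ni kM.
  rewrite !big_ord1/= a0 subr0.
  have := @lint_cell_le R s x0 0 (a 1%N) (M 0%N)
    (fun x => Num.max 0 (M 0%N - k x)) s1.
  move/(_ _ _ (a_ge0 1%N) (lexx _) _) => H; apply: le_trans (H _ _ _) _.
  - by apply: lebesgue_measurable_pos; exact: lebesgue_measurableB.
  - move=> x; rewrite le_max lexx/= ge_max M0//=.
    by rewrite gerBl.
  - by move=> x; lra.
  - rewrite lee_fin subr0 max_r//.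
    set e := Num.max 0 _.
    have ae : a 1%N - eta <= e by rewrite /e le_max lexx orbT.
    by have := M0 0%N isT; nra.
set w := M n.+1.
have w0 : 0 <= w by exact: M0.
have wM i : (i <= n.+1)%N -> w <= M i.
  rewrite /w; elim: n {IH M0 kM w w0} => [|n IHn].
    by case: i => [|[|//]] _.
  rewrite leq_eqVlt => /orP[/eqP->//|]; rewrite ltnS => /IHn; exact: le_trans.
set k1 := fun x => Num.max 0 (k x - w).
have mk1 : lebesgue_measurable k1.
  by apply: lebesgue_measurable_pos; exact: lebesgue_measurableB.
set u := fun x => Num.max 0 (w - k x).
have mu : lebesgue_measurable u.
  by apply: lebesgue_measurable_pos; exact: lebesgue_measurableB.
have u0 x : 0 <= u x by rewrite /u le_max lexx.
pose v i x := Num.max 0 (M i - w - k1 x).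
have mv i : lebesgue_measurable (v i).
  by apply: lebesgue_measurable_pos; exact: lebesgue_measurableB.
have v0 i x : 0 <= v i x by rewrite /v le_max lexx.
have split i : (i <= n.+1)%N -> forall x, Num.max 0 (M i - k x) = u x + v i x.
  move=> iN x; have wMi := wM i iN; rewrite /u /v /k1.
  have [kw|wk] := leP (k x) w.
    rewrite (max_r (_ : 0 <= w - _)); last by lra.
    rewrite (max_l (_ : k x - w <= 0)); last by lra.
    by rewrite !max_r; lra.
  rewrite (max_l (_ : w - _ <= 0)); last by lra.
  rewrite (max_r (_ : 0 <= k x - w)); last by lra.
  by rewrite add0r; congr Num.max; lra.
have -> : (\sum_(i < n.+2)
    lint (cell s x0 (a i) (a i.+1)) (fun x => Num.max 0 (M i - k x))%R =
  \sum_(i < n.+2) lint (cell s x0 (a i) (a i.+1)) u +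
  \sum_(i < n.+2) lint (cell s x0 (a i) (a i.+1)) (v i))%E.
  rewrite -big_split/=; apply: eq_bigr => i _; rewrite -lintD//.
  by apply: eq_lint => x _; apply: split; rewrite -ltnS.
rewrite lint_cell_sum// [X in (_ + X)%E]big_ord_recr/=.
rewrite [X in (_ + (_ + X))%E](@eq_lint _ _ _ (fun=> 0)); last first.
  move=> x _; rewrite /v subrr; apply: max_l.
  by rewrite sub0r oppr_le0 /k1 le_max lexx.
rewrite lint0 adde0 a0.
have Hu : (lint (cell s x0 0 (a n.+2)) u <=
    (w * Num.max 0 (a n.+2 - n.+1%:R * eta))%:E)%E.
  apply: lint_cell_le => //.
  - by move=> x; rewrite u0 /u ge_max w0 gerBl k0.
  - exact: mulr_ge0.
  - by move=> x xn; apply: max_l; rewrite subr_le0; exact: kM.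
have Hv := IH (fun i => M i - w) k1 mk1.
have {}Hv : (\sum_(i < n.+1) lint (cell s x0 (a i) (a i.+1)) (v i) <=
  (\sum_(i < n.+1) (M i - w) * Num.max 0 (a i.+1 - a i - eta) +
   eta * (M 0%N - w))%:E)%E.
  apply: Hv.
  - by move=> x; rewrite /k1 le_max lexx.
  - by move=> i iN; rewrite subr_ge0; apply: wM; rewrite leqW.
  - by move=> i; rewrite lerD2r.
  - move=> i x iN xi; rewrite /k1 le_max; apply/orP; right.
    by rewrite lerD2r; apply: kM => //; rewrite leqW.
apply: le_trans (leeD Hu Hv) _; rewrite -EFinD lee_fin.
set e := fun i => Num.max 0 (a i.+1 - a i - eta).
have e0 i : 0 <= e i by rewrite /e le_max lexx.
(* The i-th cell is no longer than [e i + eta], whereas [k >= w] is known up to distance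
   [(n + 1) eta] only. So the lowest level costs [w] times the sum of the [e i] plus one spare
   [eta]; over all levels the spare terms add up to [eta * M 0]. *)
have Ha : a n.+2 <= \sum_(i < n.+2) e i + n.+2%:R * eta.
  elim: n.+2 => [|j IHj]; first by rewrite big_ord0 a0; lra.
  rewrite big_ord_recr/= -natr1 mulrDl mul1r.
  have : a j.+1 - a j - eta <= e j by rewrite /e le_max lexx orbT.
  lra.
rewrite -/e [leRHS](_ : _ = \sum_(i < n.+1) (M i - w) * e i +
   w * \sum_(i < n.+2) e i + eta * M 0%N); last first.
  rewrite big_ord_recr [in w * _]big_ord_recr/= -/w mulrDr mulr_sumr.
  congr (_ + _); rewrite addrA -big_split/=; congr (_ + _).
  by apply: eq_bigr => i _; rewrite -mulrDl subrK.
have : Num.max 0 (a n.+2 - n.+1%:R * eta) <= \sum_(i < n.+2) e i + eta.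
  rewrite ge_max addr_ge0//=; last exact: sumr_ge0.
  by move: Ha; rewrite -natr1 mulrDl mul1r; lra.
move/(ler_wpM2l w0); lra.
Qed.

(** A lower Riemann sum: the i-th regular cell uses the level [M i.+1] of its outer end. The index
    shift makes it differ from the corresponding upper sum by the first term, [eta * M 0]. *)
Lemma lint_step_lower {R : realType} (s x0 eta : R) (k : R -> R)
    (M : nat -> R) n :
  s = 1 \/ s = -1 -> lebesgue_measurable k -> 0 <= eta ->
  (forall x, 0 <= k x) -> (forall i, 0 <= M i) ->
  (forall i x, 0 < s * (x - x0) <= i%:R * eta -> M i <= k x) ->
  ((\sum_(i < n) eta * M i.+1)%:E <= lint (cell s x0 0 (n%:R * eta)) k)%E.
Proof.
move=> s1 mk eta0 k0 M0 kM.
have := @lint_cell_sum R s x0 (fun i => i%:R * eta) k n mk k0.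
rewrite /= mul0r => <-; last first.
  by move=> i; rewrite ler_wpM2r// ler_nat.
rewrite -sumEFin; apply: lee_sum => i _.
apply: (@le_trans _ _ (lint (cell s x0 (i%:R * eta) (i.+1%:R * eta))
  (fun=> M i.+1))).
  rewrite lint_cst// cell_measure//; last by rewrite ler_wpM2r// ler_nat.
  by rewrite -EFinM lee_fin -natr1; lra.
apply: lint_le => // x; rewrite /cell/= => /andP[? ?]; apply: kM.
by apply/andP; split => //; apply: le_lt_trans (_ : i%:R * eta < _) => //; exact: mulr_ge0.
Qed.

(** For [c > 0] the hypothesis bounds [g] on [B] by a constant; integrate over [B] and raise to the
    power [m]. Using it once in [y] and once in [x] gives the Prekopa-Leindler inequality on a pair
    of cells with constant right-hand side. *)
Lemma powR_mass_le {R : realType} (B : set R) (g : R -> R) (m c q M mass : R) :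
  lset B -> @completed_lebesgue_measure R B = q%:E -> lebesgue_measurable g ->
  (forall y, 0 <= g y) -> 0 < m -> 0 <= c -> 0 <= M -> 0 <= q ->
  (forall y, B y -> g y `^ m * c <= M) -> lint B g = mass%:E ->
  mass `^ m * c <= q `^ m * M.
Proof.
move=> mB muB mg g0 m0 c0 M0 q0 gM gmass.
have mass0 : 0 <= mass by rewrite -lee_fin -gmass lint_ge0.
have [->|cn0] := eqVneq c 0; first by rewrite mulr0 mulr_ge0 ?powR_ge0.
have cgt0 : 0 < c by rewrite lt_neqAle eq_sym cn0.
set b := (M / c) `^ m^-1.
have b0 : 0 <= b by exact: powR_ge0.
have gb y : B y -> g y <= b.
  move=> By; have := gM y By; rewrite -ler_pdivlMr// => H.
  have -> : g y = (g y `^ m) `^ m^-1 by rewrite -powRrM divff ?gt_eqF// powRr1.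
  apply: ge0_ler_powR => //; rewrite ?nnegrE ?invr_ge0 ?powR_ge0 ?divr_ge0//.
  exact: ltW.
have : (lint B g <= lint B (fun=> b))%E by apply: lint_le.
rewrite gmass lint_cst// muB -EFinM lee_fin => H.
have : mass `^ m <= (b * q) `^ m.
  by apply: ge0_ler_powR; rewrite ?nnegrE ?mulr_ge0//; exact: ltW.
rewrite powRM// /b -powRrM mulVf ?gt_eqF// powRr1 ?divr_ge0// => H2.
rewrite -ler_pdivlMr//; apply: le_trans H2 _.
by rewrite mulrAC [M * _]mulrC.
Qed.

(* Fixing x bounds g on B, hence its integral, and so bounds f x by a constant u
   that does not depend on x; as p * u is close to the integral of f over A, f is
   close to constant on A in L1. *)
Lemma prekopa_leindler_cell {R : realType} (A B : set R) (f g : R -> R)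
    (l m p q M mass eta : R) :
  0 < l -> 0 < m -> l + m = 1 ->
  lset A -> @completed_lebesgue_measure R A = p%:E -> 0 <= p ->
  lset B -> @completed_lebesgue_measure R B = q%:E -> 0 <= q ->
  l * p + m * q = eta ->
  lebesgue_measurable f -> lebesgue_measurable g ->
  (forall x, 0 <= f x) -> (forall y, 0 <= g y) -> 0 <= M ->
  (forall x y, A x -> B y -> f x `^ l * g y `^ m <= M) ->
  lint A f = mass%:E -> lint B g = mass%:E ->
  mass <= p `^ l * q `^ m * M /\
  (lint A (fun x => Num.max 0 (f x - M))%R <=
   (2 * (eta * M - mass) / l + M * `|p - q|)%:E)%E.
Proof.
move=> l0 m0 lm mA muA p0 mB muB q0 etaE mf mg f0 g0 M0 fgM fmass gmass.
have mass0 : 0 <= mass by rewrite -lee_fin -fmass lint_ge0.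
have gprf x : A x -> f x `^ l * mass `^ m <= q `^ m * M.
  move=> Ax; rewrite mulrC; apply: (powR_mass_le B g) => //.
    exact: powR_ge0.
  by move=> y By; rewrite mulrC; exact: fgM.
have massE : mass `^ l * mass `^ m = mass.
  have [->|mn0] := eqVneq mass 0.
    by rewrite !powR0 ?gt_eqF// mul0r.
  by rewrite -powRD ?mn0 ?implybT// lm powRr1.
have mass_le : mass <= p `^ l * q `^ m * M.
  rewrite -{1}massE -mulrA; apply: (powR_mass_le A f) => //.
  - exact: powR_ge0.
  - by rewrite mulr_ge0 ?powR_ge0.
split => //.
have eta_le : p `^ l * q `^ m <= eta by rewrite -etaE; exact: weighted_am_gm.
have massM : mass <= eta * M.
  by apply: le_trans mass_le _; rewrite ler_wpM2r.
set Z := 2 * (eta * M - mass) / l.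
have Z0 : 0 <= Z by rewrite divr_ge0 ?(ltW l0)// mulr_ge0// subr_ge0.
have Mpq0 : 0 <= M * `|p - q| by rewrite mulr_ge0.
have mfM : lebesgue_measurable (fun x => Num.max 0 (f x - M)).
  by apply: lebesgue_measurable_pos; exact: lebesgue_measurableB.
have le_mass : (lint A (fun x => Num.max 0 (f x - M))%R <= mass%:E)%E.
  rewrite -fmass; apply: lint_le => // x _; first by rewrite le_max lexx.
  by rewrite ge_max f0 gerBl.
have [mass_eq0|massn0] := eqVneq mass 0.
  by apply: le_trans le_mass _; rewrite lee_fin mass_eq0 addr_ge0.
have mass_gt0 : 0 < mass by rewrite lt_neqAle eq_sym massn0.
have massm_gt0 := powR_gt0 m mass_gt0.
set u := (q `^ m * M / mass `^ m) `^ l^-1.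
have u0 : 0 <= u by exact: powR_ge0.
have fu x : A x -> f x <= u.
  move=> Ax; have := gprf x Ax; rewrite -ler_pdivlMr// => H.
  have -> : f x = (f x `^ l) `^ l^-1 by rewrite -powRrM divff ?gt_eqF// powRr1.
  apply: ge0_ler_powR => //;
    rewrite ?nnegrE ?invr_ge0 ?powR_ge0 ?divr_ge0 ?mulr_ge0 ?powR_ge0//.
  exact: ltW.
(* By the choice of [u] the left side equals [p^l q^m M / mass], and the geometric mean of [p] and
   [q] is at most [eta]. *)
have ul : (p * u / mass) `^ l <= 1 + (eta * M - mass) / mass.
  rewrite !powRM ?invr_ge0 ?mulr_ge0//.
  rewrite -powRrM mulVf ?gt_eqF// powRr1; last first.
    by rewrite divr_ge0 ?mulr_ge0 ?powR_ge0.
  have -> : mass^-1 `^ l = (mass `^ l)^-1.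
    by rewrite -powR_inv1// -powRrM mulN1r powRN.
  have -> : 1 + (eta * M - mass) / mass = eta * M / mass by field.
  rewrite [leLHS](_ : _ = p `^ l * q `^ m * M / (mass `^ l * mass `^ m)).
    by rewrite massE ler_pM2r ?invr_gt0// ler_wpM2r.
  by field; rewrite !gt_eqF ?powR_gt0.
have := @min1_le_of_powR_le R l (p * u / mass) ((eta * M - mass) / mass) l0.
have -> : l < 1 by lra.
have -> : 0 <= p * u / mass by rewrite divr_ge0 ?mulr_ge0.
have -> : 0 <= (eta * M - mass) / mass by rewrite divr_ge0 ?subr_ge0.
move=> /(_ isT isT ul isT) H.
have {}H : Num.min mass (p * u - mass) <= Z.
  have -> : Z = mass * (2 * ((eta * M - mass) / mass) / l).
    by rewrite /Z; field; rewrite massn0 gt_eqF.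
  apply: le_trans (ler_wpM2l (ltW mass_gt0) H).
  by rewrite minr_pMr// mulr1 mulrBr mulr1 mulrCA divff// mulr1.
(* If the minimum is [mass], then [mass <= Z] and the trivial bound by the whole mass of [f] is
   enough. Otherwise the constant [u] has almost the same integral over [A] as [f]. *)
have [mu|um] := leP mass (p * u - mass).
  apply: le_trans le_mass _; rewrite lee_fin.
  by move: H; rewrite min_l//; lra.
move: H; rewrite min_r; [move=> H|exact: ltW].
apply: (@le_trans _ _ (lint A (fun=> Num.max 0 (u - M))%R)).
  apply: lint_le => // x Ax; first by rewrite le_max lexx.
  by rewrite ge_max le_max lexx/= le_max lerD2r fu ?orbT.
rewrite lint_cst// muA -EFinM lee_fin mulrC maxr_pMr// mulr0 ge_max.
rewrite addr_ge0//=.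
have -> : p * (u - M) = (p * u - mass) + (mass - eta * M) + (eta - p) * M by ring.
have : (eta - p) * M <= M * `|p - q|.
  rewrite mulrC ler_wpM2l// -etaE.
  have -> : l * p + m * q - p = m * (q - p).
    by rewrite (_ : l = 1 - m); [ring|lra].
  apply: (@le_trans _ _ (m * `|p - q|)).
    by rewrite ler_pM2l// distrC ler_norm.
  by rewrite ler_piMl//; lra.
lra.
Qed.

(** On the i-th cell, [f - k] is split through the constant [M i]: [prekopa_leindler_cell] handles
    [f - M i] and [lint_step_excess] handles [M i - k]. Each costs at most [M i * |p i - q i|], so
    [dist_le_deficit] enters twice, which gives [2 * d]; the 6 is 2 from the cell plus twice 2 from
    the deficits. *)
Lemma side_estimate {R : realType} (s x0 y0 l m t d eta : R) (f g k : R -> R)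
    (a b M mass : nat -> R) (n : nat) :
  s = 1 \/ s = -1 ->
  0 < l -> 0 < m -> l + m = 1 -> 0 < t -> t <= l -> t <= m -> 0 < d -> d <= 1 ->
  0 <= eta ->
  lebesgue_measurable f -> lebesgue_measurable g -> lebesgue_measurable k ->
  (forall x, 0 <= f x) -> (forall x, 0 <= g x) -> (forall x, 0 <= k x) ->
  a 0%N = 0 -> (forall i, a i <= a i.+1) -> (forall i, b i <= b i.+1) ->
  (forall i, l * (a i.+1 - a i) + m * (b i.+1 - b i) = eta) ->
  (forall i, 0 <= M i) -> (forall i, M i.+1 <= M i) ->
  (forall i, lint (cell s x0 (a i) (a i.+1)) f = (mass i)%:E) ->
  (forall i, lint (cell s y0 (b i) (b i.+1)) g = (mass i)%:E) ->
  (forall i x y, cell s x0 (a i) (a i.+1) x -> cell s y0 (b i) (b i.+1) y ->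
     f x `^ l * g y `^ m <= M i) ->
  (forall i x, 0 < s * (x - x0) <= i%:R * eta -> M i <= k x) ->
  (forall i, mass i <= eta * M i) /\
  (lint (cell s x0 0 (a n.+1)) (fun x => Num.max 0 (f x - k x))%R <=
   (2 * d * (\sum_(i < n.+1) eta * M i) +
    6 / (t * d) * (\sum_(i < n.+1) (eta * M i - mass i)) + eta * M 0%N)%:E)%E.
Proof.
move=> s1 l0 m0 lm t0 tl tm d0 d1 eta0 mf mg mk f0 g0 k0 a0 a_nd b_nd abE.
move=> M0 M_ni fmass gmass fgM kM.
pose p i := a i.+1 - a i; pose q i := b i.+1 - b i.
have p0 i : 0 <= p i by rewrite subr_ge0.
have q0 i : 0 <= q i by rewrite subr_ge0.
have td0 : 0 < t * d by exact: mulr_gt0.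
have cellPL i : mass i <= p i `^ l * q i `^ m * M i /\
    (lint (cell s x0 (a i) (a i.+1)) (fun x => Num.max 0 (f x - M i))%R <=
     (2 * (eta * M i - mass i) / l + M i * `|p i - q i|)%:E)%E.
  apply: (@prekopa_leindler_cell R _ (cell s y0 (b i) (b i.+1)) f g l m
    (p i) (q i) (M i) (mass i) eta) => //.
  - exact: cell_measure.
  - exact: cell_measure.
  - exact: abE.
  - exact: fgM.
have massM i : mass i <= eta * M i.
  apply: le_trans (proj1 (cellPL i)) _; rewrite ler_wpM2r// -(abE i).
  exact: weighted_am_gm.
split => //.
have mfk : lebesgue_measurable (fun x => Num.max 0 (f x - k x)).
  by apply: lebesgue_measurable_pos; exact: lebesgue_measurableB.
have fk0 x : 0 <= Num.max 0 (f x - k x) by rewrite le_max lexx.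
have := @lint_cell_sum R s x0 a _ n.+1 mfk fk0 a_nd.
rewrite a0 => <-.
have stepE := @lint_step_excess R s x0 eta k M a n s1 mk eta0 k0 a0 a_nd
  (fun i _ => M0 i) M_ni (fun i x _ => kM i x).
(* Weighted by [M i], the AM-GM deficit is at most [eta * M i - mass i], because [mass i] is at most
   [M i] times the geometric mean. *)
have pqM i : M i * `|p i - q i| <=
    d * (eta * M i) + 2 * (eta * M i - mass i) / (t * d).
  have := @dist_le_deficit R l m t d eta (p i) (q i) l0 m0 lm t0 tl tm d0 d1
    (p0 i) (q0 i) (abE i).
  move=> /(ler_wpM2l (M0 i)) H; apply: le_trans H _.
  have : mass i * (t * d)^-1 <= p i `^ l * q i `^ m * M i * (t * d)^-1.
    by rewrite ler_pM2r ?invr_gt0//; exact: (proj1 (cellPL i)).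
  by move: (t * d)^-1 (p i `^ l) (q i `^ m) => ? ? ?; lra.
have cellfk i : (lint (cell s x0 (a i) (a i.+1)) (fun x => Num.max 0 (f x - k x))%R
   <= (2 * (eta * M i - mass i) / l + M i * `|p i - q i|)%:E +
   lint (cell s x0 (a i) (a i.+1)) (fun x => Num.max 0 (M i - k x))%R)%E.
  apply: le_trans (leeD (proj2 (cellPL i)) (lexx _)).
  have mfM : lebesgue_measurable (fun x => Num.max 0 (f x - M i)).
    by apply: lebesgue_measurable_pos; exact: lebesgue_measurableB.
  have mMk : lebesgue_measurable (fun x => Num.max 0 (M i - k x)).
    by apply: lebesgue_measurable_pos; exact: lebesgue_measurableB.
  rewrite -lintD//; last 2 first.
  - by move=> x _; rewrite le_max lexx.
  - by move=> x _; rewrite le_max lexx.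
  apply: lint_le => //; first exact: lebesgue_measurableD.
  move=> x _; rewrite ge_max addr_ge0 ?le_max ?lexx//=.
  have : f x - M i <= Num.max 0 (f x - M i) by rewrite le_max lexx orbT.
  have : M i - k x <= Num.max 0 (M i - k x) by rewrite le_max lexx orbT.
  lra.
apply: (@le_trans _ _ (\sum_(i < n.+1)
  ((2 * (eta * M i - mass i) / l + M i * `|p i - q i|)%:E +
   lint (cell s x0 (a i) (a i.+1)) (fun x => Num.max 0 (M i - k x))%R))%E).
  by apply: lee_sum => i _; exact: cellfk.
rewrite big_split/= sumEFin.
apply: le_trans (leeD (lexx _) stepE) _; rewrite -EFinD lee_fin.
rewrite addrA lerD2r -big_split/= !mulr_sumr -big_split/=.
apply: ler_sum => i _.
have Hl : 2 * (eta * M i - mass i) / l <= 2 * (eta * M i - mass i) / (t * d).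
  rewrite ler_wpM2l ?mulr_ge0 ?subr_ge0// lef_pV2 ?posrE//.
  by apply: le_trans (ler_piMr _ d1) tl; exact: ltW.
have Hp : Num.max 0 (a i.+1 - a i - eta) <= `|p i - q i|.
  rewrite ge_max normr_ge0/= -(abE i) -/(p i) -/(q i).
  have -> : p i - (l * p i + m * q i) = m * (p i - q i).
    by rewrite (_ : l = 1 - m); [ring|lra].
  apply: (@le_trans _ _ (m * `|p i - q i|)).
    by rewrite ler_pM2l// ler_norm.
  by rewrite ler_piMl//; lra.
have {Hp}Hp := ler_wpM2l (M0 i) Hp.
have Hpq := pqM i.
have -> : 6 / (t * d) * (eta * M i - mass i) =
  3 * (2 * (eta * M i - mass i) / (t * d)) by ring.
lra.
Qed.

(** * Equal-mass points *)

Definition cdf {R : realType} (f : R -> R) (x : R) : R :=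
  fine (lint [set y | y <= x] f).

Lemma le_lset {R : realType} (x : R) : lset [set y : R | y <= x].
Proof.
by apply: is_interval_lset => y z /= yx zx w /andP[_ wz]; exact: le_trans zx.
Qed.

Lemma gt_lset {R : realType} (x : R) : lset [set y : R | x < y].
Proof.
by apply: is_interval_lset => y z /= yx zx w /andP[yw _]; exact: lt_le_trans yw.
Qed.

Lemma lt_lset {R : realType} (x : R) : lset [set y : R | y < x].
Proof.
by apply: is_interval_lset => y z /= yx zx w /andP[_ wz]; exact: le_lt_trans zx.
Qed.

Lemma lint_set1 {R : realType} (x : R) (f : R -> R) :
  lebesgue_measurable f -> lint [set x] f = 0%E.
Proof.
move=> mf; apply: lint_null => //.
  by apply: is_interval_lset => y z /= -> -> w; rewrite -eq_le => /eqP.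
by rewrite -set_itv1 completed_lebesgue_measure_itv/= ltxx.
Qed.

(** * Continuity and limits of the distribution function *)

Section Cdf.
Context {R : realType} (f : R -> R).
Context (mf : lebesgue_measurable f) (f0 : forall x, 0 <= f x).
Context (f1 : lint setT f = 1%:E).

Lemma lint_fin (A : set R) : lset A -> (lint A f \is a fin_num)%E.
Proof.
move=> mA; rewrite ge0_fin_numE ?lint_ge0//.
apply: le_lt_trans (ltry 1%R); rewrite -f1; apply: lint_subset => //.
exact: lset_setT.
Qed.

Lemma cdfE x : lint [set y | y <= x] f = (cdf f x)%:E.
Proof. by rewrite /cdf fineK// lint_fin//; exact: le_lset. Qed.

(** Points carry no mass. The strict form fits the cells with [s = -1], which are closed on the
    left. *)
Lemma cdf_ltE x : lint [set y | y < x] f = (cdf f x)%:E.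
Proof.
rewrite -cdfE; have -> : [set y | y <= x] = [set y | y < x] `|` [set x].
  apply/seteqP; split => y /=; first by rewrite le_eqVlt => /orP[/eqP|]; auto.
  by move=> [/ltW//|->].
rewrite lintU//; last 3 first.
- exact: lt_lset.
- by apply: is_interval_lset => y z /= -> -> w; rewrite -eq_le => /eqP.
- by move=> y /=; rewrite lt_neqAle => /andP[/eqP].
by rewrite lint_set1// adde0.
Qed.

Lemma cdf_cell s x0 a b : s = 1 \/ s = -1 -> a <= b ->
  lint (cell s x0 a b) f = (s * (cdf f (x0 + s * b) - cdf f (x0 + s * a)))%:E.
Proof.
move=> [->|->] ab; rewrite ?mul1r ?mulN1r.
- have := cdfE (x0 + b).
  have -> : [set y | y <= x0 + b] = [set y | y <= x0 + a] `|` cell 1 x0 a b.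
    apply/seteqP; split => y; rewrite /cell/=.
      by case: (leP y (x0 + a)) => ? ?; [left|right; apply/andP; split; lra].
    by move=> [?|/andP[? ?]]; lra.
  rewrite lintU//; last 2 first.
  - exact: le_lset.
  - by move=> y; rewrite /cell/= => ? /andP[? ?]; lra.
  rewrite cdfE => /(congr1 (fun z => z - (cdf f (x0 + a))%:E)%E).
  by rewrite addeAC subee ?add0e// => ->; rewrite EFinB.
- have := cdf_ltE (x0 - a).
  have -> : [set y | y < x0 - a] = [set y | y < x0 - b] `|` cell (-1) x0 a b.
    apply/seteqP; split => y; rewrite /cell/=.
      by case: (ltP y (x0 - b)) => ? ?; [left|right; apply/andP; split; lra].
    by move=> [?|/andP[? ?]]; lra.
  rewrite lintU//; last 2 first.
  - exact: lt_lset.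
  - by move=> y; rewrite /cell/= => ? /andP[? ?]; lra.
  rewrite cdf_ltE => /(congr1 (fun z => z - (cdf f (x0 - b))%:E)%E).
  by rewrite addeAC subee ?add0e// => ->; rewrite -EFinB; congr (_%:E); ring.
Qed.

Lemma cdf_nd x y : x <= y -> cdf f x <= cdf f y.
Proof.
move=> xy; rewrite -lee_fin -!cdfE; apply: lint_subset => //.
- exact: le_lset.
- exact: le_lset.
- by move=> z /= /le_trans; apply.
Qed.

(** Absolute continuity of the integral, applied to short cells. *)
Lemma cdf_uniform_continuous e : 0 < e ->
  exists2 d, 0 < d & forall x y, x <= y -> y < x + d -> cdf f y - cdf f x < e.
Proof.
move=> e0.
have intf : (@completed_lebesgue_measure R).-integrable
    [set: lebT R] (EFin \o f).
  apply/integrableP; split; first exact/measurable_EFinP.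
  under eq_integral => x _ do rewrite /= ger0_norm//.
  by rewrite -/(lint setT f) f1 ltry.
have [d [d0 H]] := integral_normr_continuous intf e0.
exists d => // x y xy yxd.
have cE := @cdf_cell 1 x 0 (y - x) (or_introl erefl) ltac:(lra).
have cell_d : (@completed_lebesgue_measure R (cell 1 x 0 (y - x)) < d%:E)%E.
  by rewrite cell_measure; [rewrite lte_fin; lra|left|lra].
have := H (cell 1 x 0 (y - x)) (cell_lset _ _ _ _) cell_d.
rewrite /Rintegral; under eq_integral => z _ do rewrite ger0_norm//.
rewrite -/(lint _ f) cE/=.
by rewrite !mul1r addr0 [x + _]addrC subrK.
Qed.

Lemma cdf_continuous : continuous (cdf f).
Proof.
move=> x; apply/cvgrPdist_lt => e e0.
have [d d0 H] := cdf_uniform_continuous e e0.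
exists d => //= y /= xyd.
have [xy|yx] := leP x y.
  rewrite distrC ger0_norm ?subr_ge0; last exact: cdf_nd.
  by apply: H => //; move: xyd; rewrite distrC ger0_norm; lra.
rewrite ger0_norm ?subr_ge0; last by apply: cdf_nd; exact: ltW.
by apply: H; [exact: ltW|move: xyd; rewrite ger0_norm; lra].
Qed.

(** Monotone convergence; exhausting by left or right half-lines yields the limits of [cdf]. *)
Lemma lint_exhaust (F : nat -> set R) e : 0 < e ->
  (forall n, lset (F n)) -> (forall n, F n `<=` F n.+1) ->
  (forall x, exists n, F n x) -> exists n, ((1 - e)%:E <= lint (F n) f)%E.
Proof.
move=> e0 mF F_nd Fcover.
have FT : \bigcup_i F i = setT.
  by apply/seteqP; split => // x _; have [n] := Fcover x; exists n.
have nndF : nondecreasing_seq F.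
  by apply/nondecreasing_seqP => n; apply/subsetPset.
have := @ge0_nondecreasing_set_cvg_integral _ (lebT R) R F (EFin \o f)
  (@completed_lebesgue_measure R) nndF mF
  (fun i => lebesgue_measurable_EFin _ _ mf)
  (fun i x _ => f0 x).
rewrite FT -/(lint _ f) f1 => cv.
have : ((1 - e)%:E < 1%:E :> \bar R)%E by rewrite lte_fin; lra.
move=> /open_ereal_gt' /cv [N _ HN]; exists N; apply: ltW.
exact: (HN N (leqnn N)).
Qed.

Lemma cdf_top e : 0 < e -> exists A, forall x, A <= x -> 1 - e <= cdf f x.
Proof.
move=> e0; have [||||n Hn] := @lint_exhaust (fun n => [set y | y <= n%:R]) e.
- exact: e0.
- by move=> n; exact: le_lset.
- by move=> n x /= /le_trans; apply; rewrite ler_nat.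
- move=> x; exists (Num.truncn `|x|).+1 => /=.
  apply: le_trans (ler_norm x) _; apply: ltW; exact: truncnS_gt.
exists n%:R => x nx; apply: le_trans (cdf_nd _ _ nx).
by rewrite -lee_fin -cdfE.
Qed.

Lemma cdf_bottom e : 0 < e -> exists A, forall x, x <= A -> cdf f x <= e.
Proof.
move=> e0; have [||||n Hn] := @lint_exhaust (fun n => [set y | - n%:R < y]) e.
- exact: e0.
- by move=> n; exact: gt_lset.
- by move=> n x /=; apply: le_lt_trans; rewrite lerN2 ler_nat.
- move=> x; exists (Num.truncn `|x|).+1 => /=.
  by rewrite ltrNl; apply: le_lt_trans (truncnS_gt _); rewrite -normrN ler_norm.
exists (- n%:R) => x nx; apply: le_trans (cdf_nd _ _ nx) _.
have : lint setT f =
    (lint [set y | (y <= - n%:R)%R] f + lint [set y | (- n%:R < y)%R] f)%E.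
  rewrite -lintU//.
  - congr lint; apply/seteqP; split => // y _ /=.
    by case: (leP y (- n%:R)); [left|right].
  - exact: le_lset.
  - exact: gt_lset.
  - by move=> y /= ? ?; lra.
rewrite f1 cdfE => H.
have := leeD (lexx (cdf f (- n%:R))%:E) Hn; rewrite -H -EFinD lee_fin; lra.
Qed.

End Cdf.

(** * Pairs of points with equal masses to their left *)

Section BalancedCurve.
Context {R : realType} (f g : R -> R) (l m : R).
Context (mf : lebesgue_measurable f) (f0 : forall x, 0 <= f x).
Context (f1 : lint setT f = 1%:E).
Context (mg : lebesgue_measurable g) (g0 : forall x, 0 <= g x).
Context (g1 : lint setT g = 1%:E).
Context (l0 : 0 < l) (m0 : 0 < m).

Let F := cdf f.
Let G := cdf g.

(** The sign change is stated as a product so that it covers both orientations of the curve. *)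
Lemma balanced_IVT (u v : R -> R) (b0 b1 : R) : b0 <= b1 ->
  continuous u -> continuous v ->
  (F (u b0) - G (v b0)) * (F (u b1) - G (v b1)) <= 0 ->
  exists2 c, b0 <= c <= b1 & F (u c) = G (v c).
Proof.
move=> b01 cu cv H; set D := fun x => F (u x) - G (v x).
have cD : continuous D.
  move=> x; apply: (@cvgB _ R^o).
  - apply: (@continuous_comp _ _ _ u F); first exact: cu.
    exact: (cdf_continuous _ mf f0 f1).
  - apply: (@continuous_comp _ _ _ v G); first exact: cv.
    exact: (cdf_continuous _ mg g0 g1).
have [||c] := @IVT R D b0 b1 0 b01.
- exact: continuous_subspaceT.
- rewrite ge_min le_max; move: H; rewrite -/(D b0) -/(D b1).
  move=> H; apply/andP; split; apply/orP.
    by have [?|?] := ltP 0 (D b0); [right; nra|left].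
  by have [?|?] := ltP (D b0) 0; [right; nra|left].
by rewrite in_itv/= => cb /eqP; rewrite subr_eq0 => /eqP DE; exists c.
Qed.

(** Along the line [l x + m y = z], [y] decreases as [x] increases, so [F x - G y] changes sign
    between the two ends. *)
Lemma balanced_start z : exists x y, l * x + m * y = z /\ F x = G y.
Proof.
have e3 : 0 < 3^-1 :> R by rewrite invr_gt0.
have [A1 HA1] := cdf_top _ mf f0 f1 _ e3.
have [A2 HA2] := cdf_bottom _ mf f0 f1 _ e3.
have [B1 HB1] := cdf_top _ mg g0 g1 _ e3.
have [B2 HB2] := cdf_bottom _ mg g0 g1 _ e3.
set v := fun x => (z - l * x) / m.
(* The 0 in [hi] and [lo] gives [lo <= hi]. At either end one of [F], [G] is at least 2/3 and the
   other at most 1/3. *)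
set hi := Num.max 0 (Num.max A1 ((z - m * B2) / l)).
set lo := Num.min 0 (Num.min A2 ((z - m * B1) / l)).
have v_top : B1 <= v lo.
  rewrite /v ler_pdivlMr//.
  have : lo <= (z - m * B1) / l by rewrite /lo !ge_min lexx !orbT.
  by rewrite ler_pdivlMr//; lra.
have v_bot : v hi <= B2.
  rewrite /v ler_pdivrMr//.
  have : (z - m * B2) / l <= hi by rewrite /hi !le_max lexx !orbT.
  by rewrite ler_pdivrMr//; lra.
have Fhi := HA1 hi ltac:(by rewrite /hi !le_max lexx !orbT).
have Flo := HA2 lo ltac:(by rewrite /lo !ge_min lexx !orbT).
have Ghi := HB2 _ v_bot; have Glo := HB1 _ v_top.
have [||||c _ cE] := @balanced_IVT id v lo hi.
- by apply: (@le_trans _ _ 0); rewrite /lo /hi ?ge_min ?le_max lexx.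
- by move=> x; exact: cvg_id.
- move=> x; apply: (@cvgMl _ R^o); apply: (@cvgB _ R^o).
    exact: cvg_cst.
  by apply: (@cvgMr _ R^o); exact: cvg_id.
- rewrite /F /G /=.
  move: Fhi Flo Ghi Glo; move: (cdf f hi) (cdf f lo) (cdf g _) (cdf g _).
  by move=> a b c d ? ? ? ?; nra.
- exists c, (v c); split => //.
  by rewrite /v; field; rewrite gt_eqF.
Qed.

(** Spending the budget [eta] entirely on [y] or entirely on [x] makes [F - G] take opposite signs
    by monotonicity; some division in between restores equality. *)
Lemma balanced_step s x y eta : s = 1 \/ s = -1 -> 0 <= eta -> F x = G y ->
  exists a b, [/\ 0 <= a, 0 <= b, l * a + m * b = eta &
    F (x + s * a) = G (y + s * b)].
Proof.
move=> s1 eta0 xy.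
pose u a := x + s * a; pose v a := y + s * ((eta - l * a) / m).
have etal : 0 <= eta / l by rewrite divr_ge0// ltW.
have etam : 0 <= eta / m by rewrite divr_ge0// ltW.
have [|||c /andP[c0 c1] cE] := @balanced_IVT u v 0 (eta / l) etal.
- move=> a; apply: (@cvgD _ R^o); first exact: cvg_cst.
  by apply: (@cvgMr _ R^o); exact: cvg_id.
- move=> a; apply: (@cvgD _ R^o); first exact: cvg_cst.
  apply: (@cvgMr _ R^o); apply: (@cvgMl _ R^o); apply: (@cvgB _ R^o).
    exact: cvg_cst.
  by apply: (@cvgMr _ R^o); exact: cvg_id.
- have -> : u 0 = x by rewrite /u mulr0 addr0.
  have -> : v (eta / l) = y.
    by rewrite /v; field; rewrite !gt_eqF.
  have -> : v 0 = y + s * (eta / m) by rewrite /v mulr0 subr0.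
  rewrite /u -xy {2}xy.
  case: s1 => ->.
  + have := cdf_nd _ mf f0 f1 x (x + 1 * (eta / l)) ltac:(lra).
    have := cdf_nd _ mg g0 g1 y (y + 1 * (eta / m)) ltac:(lra).
    rewrite -/F -/G; nra.
  + have := cdf_nd _ mf f0 f1 (x + -1 * (eta / l)) x ltac:(lra).
    have := cdf_nd _ mg g0 g1 (y + -1 * (eta / m)) y ltac:(lra).
    rewrite -/F -/G; nra.
exists c, ((eta - l * c) / m); split => //.
- by rewrite divr_ge0 ?(ltW m0)// subr_ge0 mulrC -ler_pdivlMr.
- by field; rewrite gt_eqF.
Qed.

Lemma balanced_seq s x0 y0 eta : s = 1 \/ s = -1 -> 0 <= eta -> F x0 = G y0 ->
  exists a b : nat -> R,
    [/\ a 0%N = 0, b 0%N = 0, (forall i, a i <= a i.+1),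
        (forall i, b i <= b i.+1) &
        (forall i, l * (a i.+1 - a i) + m * (b i.+1 - b i) = eta) /\
        (forall i, F (x0 + s * a i) = G (y0 + s * b i))].
Proof.
move=> s1 eta0 xy0.
pose P (p : R * R) := F (x0 + s * p.1) = G (y0 + s * p.2).
(* The relation is conditional on [P p], so that every pair has a successor and dependent choice
   applies; [P] then propagates from the starting pair. *)
pose Q (p q : R * R) := P p -> [/\ p.1 <= q.1, p.2 <= q.2,
  l * (q.1 - p.1) + m * (q.2 - p.2) = eta & P q].
have step p : {q | Q p q}.
  apply: cid; have [Pp|nPp] := pselect (P p); last by exists p.
  have [a [b [a0 b0 ab Fab]]] := balanced_step _ _ _ _ s1 eta0 Pp.
  exists (p.1 + a, p.2 + b) => _; split; rewrite /P/=.
  - by rewrite lerDl.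
  - by rewrite lerDl.
  - by rewrite -ab; ring.
  - rewrite ![s * (_ + _)]mulrDr ![_ + (_ + _)]addrA; exact: Fab.
have [c [c0 cQ]] := dependent_choice step (0, 0).
have cP i : P (c i).
  elim: i => [|i IH]; first by rewrite c0 /P/= !mulr0 !addr0.
  by have [] := cQ i IH.
exists (fun i => (c i).1), (fun i => (c i).2); split; rewrite ?c0//.
- by move=> i; have [] := cQ i (cP i).
- by move=> i; have [] := cQ i (cP i).
- by split => i; [have [] := cQ i (cP i)|exact: cP].
Qed.

End BalancedCurve.

(** * Stability for unimodal functions *)

Lemma lint_two_sides {R : realType} (x0 a b : R) (u : R -> R) :
  lebesgue_measurable u -> (forall x, 0 <= u x) -> 0 <= a -> 0 <= b ->
  lint setT u =
  ((lint [set y | (y < x0 - b)%R] u + lint (cell (-1) x0 0 b) u) +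
   (lint (cell 1 x0 0 a) u + lint [set y | (x0 + a < y)%R] u))%E.
Proof.
move=> mu u0 a0 b0.
have L : lset [set y : R | y < x0].
  exact: lt_lset.
have U : lset [set y : R | x0 < y].
  exact: gt_lset.
have S1 : lset [set x0].
  by apply: is_interval_lset => y z /= -> -> w; rewrite -eq_le => /eqP.
have -> : [set: R] = [set y | y < x0] `|` ([set x0] `|` [set y | x0 < y]).
  apply/seteqP; split => // y _ /=.
  by have [?|?|->] := ltgtP y x0; [left|right; right|right; left].
rewrite lintU//; last 2 first.
- exact: measurableU.
- by move=> y /= ? [|]; lra.
rewrite lintU//; last by move=> y /= ->; rewrite ltxx.
rewrite lint_set1// add0e; congr (_ + _)%E.
- rewrite -lintU//.
  + congr lint; apply/seteqP; split => y; rewrite /cell/=.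
      by case: (ltP y (x0 - b)) => ? ?; [left|right; apply/andP; split; lra].
    by move=> [?|/andP[? ?]]; lra.
  + exact: lt_lset.
  + by move=> y; rewrite /cell/= => ? /andP[? ?]; lra.
- rewrite -lintU//.
  + congr lint; apply/seteqP; split => y; rewrite /cell/=.
      by case: (ltP (x0 + a) y) => ? ?; [right|left; apply/andP; split; lra].
    by move=> [/andP[? ?]|?]; lra.
  + exact: gt_lset.
  + by move=> y; rewrite /cell/= => /andP[? ?] ?; lra.
Qed.

(* s = 1 and s = -1 select the two sides of z0. Nothing is required at z0 itself: a
   log-concave function need not attain its supremum at an end of its support. *)
Definition unimodal_on_sides {R : realType} (z0 : R) (h : R -> R) :=
  forall s x y, s = 1 \/ s = -1 ->
    0 < s * (x - z0) -> s * (x - z0) <= s * (y - z0) -> h y <= h x.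

(** One side of the mode. [S] is an upper Riemann sum for [h], and [W] is the common mass of [f] and
    [g] in the cells used; all but a tail [e] is reached. The witnesses are exported so that the two
    sides can be added. *)
Lemma side_bounds {R : realType} (s x0 y0 z0 l m t d eta e B : R)
    (f g h : R -> R) :
  s = 1 \/ s = -1 ->
  0 < l -> 0 < m -> l + m = 1 -> 0 < t -> t <= l -> t <= m -> 0 < d -> d <= 1 ->
  0 < eta -> 0 < e ->
  lebesgue_measurable f -> lebesgue_measurable g ->
  (forall x, 0 <= f x) -> (forall x, 0 <= g x) -> (forall x, 0 <= h x <= B) ->
  lint setT f = 1%:E -> lint setT g = 1%:E ->
  (forall c, lebesgue_measurable (fun x => h (x + c))) ->
  unimodal_on_sides z0 h ->
  (forall x y, f x `^ l * g y `^ m <= h (l * x + m * y)) ->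
  l * x0 + m * y0 = z0 -> cdf f x0 = cdf g y0 ->
  exists a b c S W : R, let bound :=
      2 * d * S + 6 / (t * d) * (S - W) + eta * B in
    [/\ [/\ 0 <= a, 0 <= b & 0 <= c],
        cdf f (x0 + s * a) = cdf g (y0 + s * b) /\
        W = s * (cdf f (x0 + s * a) - cdf f x0),
        (s = 1 -> 1 - e <= cdf f (x0 + s * a)) /\
        (s = -1 -> cdf f (x0 + s * a) <= e),
        W <= S /\ ((S - eta * B)%:E <= lint (cell s z0 0 c) h)%E &
        (lint (cell s x0 0 a)
           (fun x => Num.max 0 (f x - h (x + (z0 - x0))))%R <= bound%:E)%E /\
        (lint (cell s y0 0 b)
           (fun x => Num.max 0 (g x - h (x + (z0 - y0))))%R <= bound%:E)%E].
Proof.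
move=> s1 l0 m0 lm t0 tl tm d0 d1 eta0 e0 mf mg f0 g0 hB f1 g1 mh uh fgh xyz Fxy.
have h0 x : 0 <= h x by case/andP: (hB x).
have B0 : 0 <= B by have /andP[h00] := hB 0; exact: le_trans.
have eta_ge0 := ltW eta0.
have [a [b [a0 b0 a_nd b_nd [abE FabE]]]] := balanced_seq f g l m mf f0 f1 mg g0
  g1 l0 m0 s x0 y0 eta s1 eta_ge0 Fxy.
have a_ge0 i : 0 <= a i by elim: i => [|i IH]; rewrite ?a0//; apply: le_trans IH _.
have b_ge0 i : 0 <= b i by elim: i => [|i IH]; rewrite ?b0//; apply: le_trans IH _.
have ablE i : l * a i + m * b i = i%:R * eta.
  elim: i => [|i IH]; first by rewrite a0 b0; ring.
  by have := abE i; rewrite -natr1; lra.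
(* Later cells take the value at their inner end, which dominates by unimodality. The first cell
   touches [z0], where only the global bound [B] is available. *)
pose M i := if i is 0%N then B else h (z0 + s * (i%:R * eta)).
have M0 i : 0 <= M i by case: i => [|i]; rewrite /M ?h0.
have sK x : s * (s * x) = x by case: s1 => ->; ring.
have M_ni i : M i.+1 <= M i.
  case: i => [|i] /=; first by case/andP: (hB (z0 + s * (1%:R * eta))).
  apply: (uh s) => //; rewrite ![z0 + _]addrC !addrK !sK.
    by rewrite mulr_gt0// ltr0n.
  by rewrite ler_pM2r// ler_nat.
have M_ge i x : i%:R * eta < s * (x - z0) -> h x <= M i.
  move=> ix; case: i ix => [|i] ix /=; first by case/andP: (hB x).
  apply: (uh s) => //; rewrite [z0 + _]addrC addrK sK; last exact: ltW.
  by rewrite mulr_gt0// ltr0n.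
have M_le i x : 0 < s * (x - z0) <= i%:R * eta -> M i <= h x.
  case: i => [|i] /andP[sx xi]; first by move: xi; rewrite mul0r; lra.
  by apply: (uh s) => //; rewrite [z0 + _]addrC addrK sK.
pose mass i := s * (cdf f (x0 + s * a i.+1) - cdf f (x0 + s * a i)).
have fmass i : lint (cell s x0 (a i) (a i.+1)) f = (mass i)%:E.
  by rewrite (cdf_cell f).
have gmass i : lint (cell s y0 (b i) (b i.+1)) g = (mass i)%:E.
  by rewrite (cdf_cell g)// -!FabE.
have cellPL i x y : cell s x0 (a i) (a i.+1) x -> cell s y0 (b i) (b i.+1) y ->
    f x `^ l * g y `^ m <= M i.
  rewrite /cell/= => /andP[xa _] /andP[yb _]; apply: le_trans (fgh x y) _.
  apply: M_ge; rewrite -ablE -xyz.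
  have -> : s * (l * x + m * y - (l * x0 + m * y0)) =
    l * (s * (x - x0)) + m * (s * (y - y0)) by ring.
  by apply: ltrD; rewrite ltr_pM2l.
have kM (w : R) i x : 0 < s * (x - w) <= i%:R * eta -> M i <= h (x + (z0 - w)).
  move=> H; apply: M_le; move: H.
  by have -> : x + (z0 - w) - z0 = x - w by ring.
have [A HA] : exists A, forall x, A <= s * x -> (s = 1 -> 1 - e <= cdf f x) /\
    (s = -1 -> cdf f x <= e).
  case: s1 => ->.
    have [A HA] := cdf_top f mf f0 f1 e e0; exists A => x; rewrite mul1r => Ax.
    by split=> [_|]; [exact: HA|lra].
  have [A HA] := cdf_bottom f mf f0 f1 e e0; exists (- A) => x Ax.
  by split=> [|_]; [lra|apply: HA; lra].
have [A' HA'] : exists A, forall x, A <= s * x -> (s = 1 -> 1 - e <= cdf g x) /\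
    (s = -1 -> cdf g x <= e).
  case: s1 => ->.
    have [A' HA'] := cdf_top g mg g0 g1 e e0; exists A' => x; rewrite mul1r => Ax.
    by split=> [_|]; [exact: HA'|lra].
  have [A' HA'] := cdf_bottom g mg g0 g1 e e0; exists (- A') => x Ax.
  by split=> [|_]; [lra|apply: HA'; lra].
(* Enough cells are taken that the weighted mean of the two end points, in direction [s], passes
   both thresholds. *)
pose T := Num.max A A' - s * z0.
pose n := Num.truncn (`|T| / eta).
have nT : T <= n.+1%:R * eta.
  apply: le_trans (ler_norm T) _; rewrite -ler_pdivrMr//.
  by apply: ltW; exact: truncnS_gt.
have side0 : 0 <= n.+1%:R * eta by exact: mulr_ge0.
pose S := \sum_(i < n.+1) eta * M i.
pose W := \sum_(i < n.+1) mass i.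
have [massM Hf] := side_estimate s x0 y0 l m t d eta f g
  (fun x => h (x + (z0 - x0))) a b M mass n s1 l0 m0 lm t0 tl tm d0 d1 eta_ge0
  mf mg (mh _) f0 g0 (fun x => h0 _) a0 a_nd b_nd abE M0 M_ni fmass gmass cellPL
  (kM x0).
(* The estimate is symmetric under exchanging [f, l, x0] with [g, m, y0]; the levels and masses are
   shared. *)
have [_ Hg] := side_estimate s y0 x0 m l t d eta g f
  (fun x => h (x + (z0 - y0))) b a M mass n s1 m0 l0
  ltac:(by rewrite addrC) t0 tm tl d0 d1 eta_ge0
  mg mf (mh _) g0 f0 (fun x => h0 _) b0 b_nd a_nd
  (fun i => etrans (addrC _ _) (abE i)) M0 M_ni gmass fmass
  (fun i x y xi yi => eq_ind _ (fun z => z <= M i) (cellPL i y x yi xi) _ (mulrC _ _))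
  (kM y0).
have SW : \sum_(i < n.+1) (eta * M i - mass i) = S - W by rewrite sumrB.
have M0E : M 0%N = B by [].
exists (a n.+1), (b n.+1), (n%:R * eta), S, W; split.
- by split => //; exact: mulr_ge0.
- split; first exact: FabE.
  rewrite /W /mass -mulr_sumr; congr (_ * _).
  rewrite -(big_mkord xpredT (fun i => cdf f (x0 + s * a i.+1) - cdf f (x0 + s * a i))).
  by rewrite telescope_sumr// a0 mulr0 addr0.
(* Since the weighted mean passes the thresholds, one of the end points does; equality of the two
   [cdf] values transfers the tail bound if it is the [y] one. *)
- have [xz|yz] : Num.max A A' <= s * (x0 + s * a n.+1) \/
      Num.max A A' <= s * (y0 + s * b n.+1).
    have abn := ablE n.+1.
    have [?|H1] := leP (Num.max A A') (s * (x0 + s * a n.+1)); first by left.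
    have [?|H2] := leP (Num.max A A') (s * (y0 + s * b n.+1)); first by right.
    exfalso; move: nT H1 H2; rewrite /T !mulrDr !sK -abn -xyz.
    move: (Num.max A A') => Z H0 H1 H2.
    have H3 : l * (s * x0 + a n.+1) < l * Z by rewrite ltr_pM2l.
    have H4 : m * (s * y0 + b n.+1) < m * Z by rewrite ltr_pM2l.
    have H5 : l * Z + m * Z = Z by rewrite -mulrDl lm mul1r.
    lra.
  + by apply: HA; apply: le_trans xz; rewrite le_max lexx.
  + by rewrite FabE; apply: HA'; apply: le_trans yz; rewrite le_max lexx orbT.
- split; first by apply: ler_sum => i _; exact: massM.
  have -> : S - eta * B = \sum_(i < n) eta * M i.+1.
    by rewrite /S big_ord_recl M0E addrC addKr.
  apply: lint_step_lower => //.
  by have := mh 0; under eq_fun do rewrite addr0.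
- by split; [move: Hf|move: Hg]; rewrite SW M0E.
Qed.

Lemma lint_pos_two_sides {R : realType} (f k : R -> R) (x0 a b e v w : R) :
  lebesgue_measurable f -> lebesgue_measurable k ->
  (forall x, 0 <= f x) -> (forall x, 0 <= k x) -> lint setT f = 1%:E ->
  0 <= a -> 0 <= b -> 1 - e <= cdf f (x0 + a) -> cdf f (x0 - b) <= e ->
  (lint (cell 1 x0 0 a) (fun x => Num.max 0 (f x - k x))%R <= v%:E)%E ->
  (lint (cell (-1) x0 0 b) (fun x => Num.max 0 (f x - k x))%R <= w%:E)%E ->
  (lint setT (fun x => Num.max 0 (f x - k x))%R <= (2 * e + v + w)%:E)%E.
Proof.
move=> mf mk f0 k0 f1 a0 b0 Fa Fb Hv Hw.
have mu : lebesgue_measurable (fun x => Num.max 0 (f x - k x)).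
  by apply: lebesgue_measurable_pos; exact: lebesgue_measurableB.
have u0 x : 0 <= Num.max 0 (f x - k x) by rewrite le_max lexx.
have uf x : Num.max 0 (f x - k x) <= f x by rewrite ge_max f0 gerBl k0.
have below : (lint [set y | (y < x0 - b)%R]
    (fun x => Num.max 0 (f x - k x))%R <= e%:E)%E.
  apply: (@le_trans _ _ (lint [set y | (y < x0 - b)%R] f)).
    by apply: lint_le => //; exact: lt_lset.
  by rewrite (cdf_ltE f)// lee_fin.
have above : (lint [set y | (x0 + a < y)%R]
    (fun x => Num.max 0 (f x - k x))%R <= e%:E)%E.
  apply: (@le_trans _ _ (lint [set y | (x0 + a < y)%R] f)).
    by apply: lint_le => //; exact: gt_lset.
  have : lint setT f = (lint [set y | (y <= x0 + a)%R] f +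
      lint [set y | (x0 + a < y)%R] f)%E.
    rewrite -lintU//.
    - congr lint; apply/seteqP; split => // y _ /=.
      by case: (leP y (x0 + a)); [left|right].
    - exact: le_lset.
    - exact: gt_lset.
    - by move=> y /= H1 H2; have := le_lt_trans H1 H2; rewrite ltxx.
  rewrite f1 (cdfE f)// => /(congr1 (fun z => z - (cdf f (x0 + a))%:E)%E).
  rewrite [in RHS]addeAC subee// add0e => <-.
  by rewrite -EFinB lee_fin; lra.
rewrite (@lint_two_sides _ x0 a b)//.
apply: le_trans (leeD (leeD below Hw) (leeD Hv above)) _.
by rewrite -!EFinD lee_fin; lra.
Qed.

(** Integrate [|f - k| + f = k + 2 max(0, f - k)]: if [k] has hardly more mass than [f], a one-sided
    bound controls the distance. *)
Lemma lint_dist_le {R : realType} (f k : R -> R) (e v : R) :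
  lebesgue_measurable f -> lebesgue_measurable k ->
  (forall x, 0 <= f x) -> (forall x, 0 <= k x) -> lint setT f = 1%:E ->
  (lint setT k <= (1 + e)%:E)%E ->
  (lint setT (fun x => Num.max 0 (f x - k x))%R <= v%:E)%E ->
  (lint setT (fun x => `|f x - k x|)%R <= (e + 2 * v)%:E)%E.
Proof.
move=> mf mk f0 k0 f1 k1 Hv.
have mu : lebesgue_measurable (fun x => Num.max 0 (f x - k x)).
  by apply: lebesgue_measurable_pos; exact: lebesgue_measurableB.
have u0 x : 0 <= Num.max 0 (f x - k x) by rewrite le_max lexx.
have mn : lebesgue_measurable (fun x => `|f x - k x|).
  by apply: lebesgue_measurable_norm; exact: lebesgue_measurableB.
have E : (lint setT (fun x => `|f x - k x|)%R + lint setT f =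
    lint setT k + 2%:E * lint setT (fun x => Num.max 0 (f x - k x))%R)%E.
  have mZ := lebesgue_measurableZ 2 _ mu.
  rewrite -lintZ// -?lintD//; try exact: lset_setT.
  - apply: eq_lint => x _; have [fk|kf] := leP (f x) (k x).
      by rewrite max_l ?subr_le0// ler0_norm ?subr_le0//; ring.
    rewrite max_r ?subr_ge0; last exact: ltW.
    by rewrite gtr0_norm ?subr_gt0//; ring.
  - by move=> x _; rewrite mulr_ge0.
have H : (lint setT (fun x => `|f x - k x|)%R + 1%:E <= (1 + e)%:E + 2%:E * v%:E)%E.
  by rewrite -f1 E; apply: leeD => //; rewrite lee_pmul2l// lte_fin.
rewrite -(@leeD2rE _ 1%:E)// -EFinD; apply: le_trans H _.
by rewrite -EFinM -EFinD lee_fin; lra.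
Qed.

(** The total loss [S - W] is at most [2 e], and [e = t d^2] turns [6 / (t d)] times this into
    [12 d]. The other terms are absorbed using [e <= d / 2]; 35 is rounded up. *)
Lemma sides_total_le {R : realType} (t d e v S1 W1 S2 W2 : R) :
  0 < t -> t <= 1 / 2 -> 0 < d -> d <= 1 -> e = t * d ^+ 2 -> v <= e / 4 ->
  S1 + S2 <= 1 + e + 2 * v -> 1 - e / 2 <= W1 + W2 ->
  e + 2 * (2 * (e / 4) + (2 * d * S1 + 6 / (t * d) * (S1 - W1) + v) +
    (2 * d * S2 + 6 / (t * d) * (S2 - W2) + v)) <= 35 * d.
Proof.
move=> t0 t2 d0 d1 eE ve SE WE.
have H4 : e <= d / 2.
  apply: (@le_trans _ _ (t * d)).
    by rewrite eE expr2 ler_pM2l// ler_piMr// ltW.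
  by rewrite -[leRHS]mulrC ler_pM2r//; lra.
have H1 : 2 * d * (S1 + S2) <= 2 * d * (1 + 3 / 2 * e).
  by rewrite ler_pM2l ?mulr_gt0//; lra.
have H2 : 6 / (t * d) * ((S1 + S2) - (W1 + W2)) <= 6 / (t * d) * (2 * e).
  by rewrite ler_pM2l; [lra|apply: divr_gt0; [lra|exact: mulr_gt0]].
have H3 : 6 / (t * d) * (2 * e) = 12 * d.
  by rewrite eE; field; rewrite !gt_eqF.
have H5 : d * e <= d / 2.
  by rewrite ler_pM2l//; lra.
rewrite H3 in H2; move: (6 / (t * d)) H1 H2 => Z H1 H2; lra.
Qed.

Lemma prekopa_leindler_stability_unimodal {R : realType} (l m t e B z0 : R)
    (f g h : R -> R) :
  0 < l -> 0 < m -> l + m = 1 -> 0 < t -> t <= l -> t <= m -> 0 < e -> e <= t ->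
  lebesgue_measurable f -> lebesgue_measurable g ->
  (forall x, 0 <= f x) -> (forall x, 0 <= g x) -> (forall x, 0 <= h x <= B) ->
  lint setT f = 1%:E -> lint setT g = 1%:E ->
  (lint setT h <= (1 + e)%:E)%E ->
  (forall c, lebesgue_measurable (fun x => h (x + c))) ->
  (forall c, lint setT (fun x => h (x + c))%R = lint setT h) ->
  unimodal_on_sides z0 h ->
  (forall x y, f x `^ l * g y `^ m <= h (l * x + m * y)) ->
  ((1 - e)%:E <= lint setT h)%E /\
  exists x0 y0, [/\ l * x0 + m * y0 = z0,
    (lint setT (fun x => `|f x - h (x + (z0 - x0))|)%R <=
       (35 * Num.sqrt (e / t))%:E)%E &
    (lint setT (fun x => `|g x - h (x + (z0 - y0))|)%R <=
       (35 * Num.sqrt (e / t))%:E)%E].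
Proof.
move=> l0 m0 lm t0 tl tm e0 et mf mg f0 g0 hB f1 g1 h1 mh hshift uh fgh.
have h0 x : 0 <= h x by case/andP: (hB x).
have B0 : 0 <= B by have /andP[h00] := hB 0; exact: le_trans.
set d := Num.sqrt (e / t).
have et0 : 0 < e / t by exact: divr_gt0.
have d0 : 0 < d by rewrite sqrtr_gt0.
have dE : d ^+ 2 = e / t by rewrite sqr_sqrtr// ltW.
have d1 : d <= 1.
  by rewrite -[leRHS]sqrtr1 ler_sqrt// ler_pdivrMr// mul1r.
have eE : e = t * d ^+ 2 by rewrite dE mulrC divfK// gt_eqF.
(* The mesh makes each discretisation error [eta * B] at most [e / 4]; the added 1 covers
   [B = 0]. *)
pose eta := e / (4 * (B + 1)).
have eta0 : 0 < eta by rewrite divr_gt0//; lra.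
have etaB : eta * B <= e / 4.
  have -> : eta * B = e / 4 * (B / (B + 1)) by rewrite /eta; field; lra.
  by rewrite ler_piMr ?divr_ge0 ?(ltW e0)// ler_pdivrMr; lra.
have [x0 [y0 [xyz Fxy]]] := balanced_start f g l m mf f0 f1 mg g0 g1 l0 m0 z0.
have e40 : 0 < e / 4 by lra.
have [a1 [b1 [c1 [S1 [W1 [[a10 b10 c10] [FG1 W1E] [top _] [WS1 hS1] [Hf1 Hg1]]]]]]] :=
  side_bounds 1 x0 y0 z0 l m t d eta (e / 4) B f g h (or_introl erefl)
  l0 m0 lm t0 tl tm d0 d1 eta0 e40 mf mg f0 g0 hB f1 g1 mh uh fgh xyz Fxy.
have [a2 [b2 [c2 [S2 [W2 [[a20 b20 c20] [FG2 W2E] [_ bot] [WS2 hS2] [Hf2 Hg2]]]]]]] :=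
  side_bounds (-1) x0 y0 z0 l m t d eta (e / 4) B f g h (or_intror erefl)
  l0 m0 lm t0 tl tm d0 d1 eta0 e40 mf mg f0 g0 hB f1 g1 mh uh fgh xyz Fxy.
move: {top bot} (top erefl) (bot erefl) => top bot.
(* The lower sums of both sides together. This bounds [S1 + S2] from above, and, through [W1 <= S1]
   and [W2 <= S2], the integral of [h] from below. *)
have hS : ((S1 + S2 - 2 * (eta * B))%:E <= lint setT h)%E.
  have mh0 : lebesgue_measurable h by have := mh 0; under eq_fun do rewrite addr0.
  rewrite (@lint_two_sides _ z0 c1 c2)//.
  apply: (@le_trans _ _ (0 + (S2 - eta * B)%:E + ((S1 - eta * B)%:E + 0))%E).
    by rewrite add0e adde0 -EFinD lee_fin; lra.
  by apply: leeD; apply: leeD => //; exact: lint_ge0.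
have WE : 1 - e / 2 <= W1 + W2 by rewrite W1E W2E; lra.
have SE : S1 + S2 <= 1 + e + 2 * (eta * B).
  by have := le_trans hS h1; rewrite lee_fin; lra.
split; first by apply: le_trans hS; rewrite lee_fin; lra.
have t2 : t <= 1 / 2 by move: tl tm lm; clear; lra.
have bound := sides_total_le t d e (eta * B) S1 W1 S2 W2 t0 t2 d0 d1 eE etaB SE WE.
exists x0, y0; split => //.
- apply: le_trans (lint_dist_le f (fun x => h (x + (z0 - x0))) e _
    mf (mh _) f0 (fun=> h0 _) f1 _ _) _.
  + by rewrite hshift.
  + apply: le_trans (lint_pos_two_sides f _ x0 a1 a2 (e / 4) _ _ mf (mh _) f0
      (fun=> h0 _) f1 a10 a20 _ _ Hf1 Hf2) _.
    * by move: top; rewrite mul1r.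
    * by move: bot; rewrite mulN1r.
    * exact: lexx.
  + by rewrite lee_fin; exact: bound.
- apply: le_trans (lint_dist_le g (fun x => h (x + (z0 - y0))) e _
    mg (mh _) g0 (fun=> h0 _) g1 _ _) _.
  + by rewrite hshift.
  + apply: le_trans (lint_pos_two_sides g _ y0 b1 b2 (e / 4) _ _ mg (mh _) g0
      (fun=> h0 _) g1 b10 b20 _ _ Hg1 Hg2) _.
    * by move: top; rewrite FG1 mul1r.
    * by move: bot; rewrite FG2 mulN1r.
    * exact: lexx.
  + by rewrite lee_fin; exact: bound.
Qed.

(** * Log-concave functions *)

Lemma lint_infty {R : realType} (h : R -> R) (s p c : R) :
  s = 1 \/ s = -1 -> lebesgue_measurable h -> (forall x, 0 <= h x) -> 0 < c ->
  (forall x, 0 < s * (x - p) -> c <= h x) -> lint setT h = +oo%E.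
Proof.
move=> s1 mh h0 c0 hc; apply/eqyP => r r0.
have rc : 0 <= r / c by rewrite divr_ge0 // ltW.
apply: (@le_trans _ _ (lint (cell s p 0 (r / c)) (fun=> c))).
  by rewrite lint_cst// cell_measure// -EFinM lee_fin subr0 mulrC divfK// gt_eqF.
apply: (@le_trans _ _ (lint (cell s p 0 (r / c)) h)).
  by apply: lint_le => // x; [rewrite ltW|rewrite /cell/= => /andP[/hc]].
by apply: lint_subset => //; exact: lset_setT.
Qed.

Lemma log_concave_midpoint {R : realType} (h : R -> R) x y :
  log_concave h -> h x * h y <= h ((x + y) / 2) ^+ 2.
Proof.
move=> [h0 lh]; have := lh x y 2^-1 ltac:(lra).
have -> : 2^-1 * x + (1 - 2^-1) * y = (x + y) / 2 by lra.
have -> : 1 - 2^-1 = 2^-1 :> R by lra.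
rewrite !powR12_sqrt// -sqrtrM// => H.
rewrite -[leLHS]sqr_sqrtr ?mulr_ge0//.
by rewrite ler_sqr ?nnegrE ?sqrtr_ge0.
Qed.

(** Blow-up near [z0] is excluded by comparison with a point [p] of positive value: if [x] lies
    between [z0] and [p], then [h x * h p <= h((x + p)/2)^2 <= h((p + z0)/2)^2]. *)
Lemma log_concave_side_bounded {R : realType} (h : R -> R) z0 s :
  log_concave h -> unimodal_on_sides z0 h -> s = 1 \/ s = -1 ->
  exists2 B, 0 <= B & forall x, 0 < s * (x - z0) -> h x <= B.
Proof.
move=> lh uh s1; have [h0 _] := lh.
have [[p [sp hp]]|nop] := pselect (exists p, 0 < s * (p - z0) /\ 0 < h p); last first.
  exists 0 => // x sx; rewrite leNgt; apply/negP => hx.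
  by apply: nop; exists x.
pose K := h ((p + z0) / 2).
exists (Num.max (h p) (K ^+ 2 / h p)) => [|x sx].
  by rewrite le_max h0.
have [px|xp] := leP (s * (p - z0)) (s * (x - z0)).
  by rewrite le_max (uh s p x).
rewrite le_max; apply/orP; right; rewrite ler_pdivlMr//.
apply: le_trans (log_concave_midpoint _ _ _ lh) _.
rewrite /K ler_sqr ?nnegrE//; apply: (uh s) => //.
  have -> : s * ((p + z0) / 2 - z0) = s * (p - z0) / 2 by field.
  by rewrite divr_gt0.
have -> : s * ((p + z0) / 2 - z0) = s * (p - z0) / 2 by field.
have -> : s * ((x + p) / 2 - z0) = s * (x - z0) / 2 + s * (p - z0) / 2 by field.
by rewrite lerDr divr_ge0// ltW.
Qed.

(** The mode is the supremum of the set [U] of points that have a larger value to their right. [U]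
    is closed downwards, with [h] increasing on it and decreasing off it. Were it empty or
    unbounded, [h] would be at least [h p] on a half-line and have infinite integral. *)
Lemma log_concave_unimodal {R : realType} (h : R -> R) p :
  log_concave h -> 0 < h p -> (lint setT h < +oo)%E ->
  exists z0 B, (forall x, 0 <= h x <= B) /\ unimodal_on_sides z0 h.
Proof.
move=> lh hp hfin; have [h0 _] := lh.
have qh := log_concave_quasi _ lh.
have mh : lebesgue_measurable h.
  exact: borel_lebesgue_measurable (quasi_concave_measurable _ qh).
pose U := [set z | exists2 w, z < w & h z < h w].
have Udown z z' : U z -> z' <= z -> U z'.
  move=> [w zw hzw] z'z; exists w; first exact: le_lt_trans zw.
  have := qh z' z w; rewrite z'z (ltW zw) => /(_ isT).
  by rewrite ge_min (leNgt (h w)) hzw orbF => H; exact: le_lt_trans hzw.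
have Und x y : x <= y -> U y -> h x <= h y.
  move=> xy [w yw hyw]; have := qh x y w; rewrite xy (ltW yw) => /(_ isT).
  by rewrite ge_min (leNgt (h w)) hyw orbF.
have nU z w : ~ U z -> z < w -> h w <= h z.
  by move=> nUz zw; rewrite leNgt; apply/negP => hzw; apply: nUz; exists w.
have U0 : U !=set0.
  apply: contrapT => U0; suff : lint setT h = +oo%E by move=> H; rewrite H in hfin.
  apply: (@lint_infty R h (-1) p (h p)) => //; first by right.
  move=> x xp; apply: nU; last by lra.
  by move=> Ux; apply: U0; exists x.
have Uub : has_ubound U.
  have [[z nUz]|allU] := pselect (exists z, ~ U z).
    exists z => w Uw; rewrite leNgt; apply/negP => zw.
    by apply: nUz; apply: Udown (ltW zw).
  exfalso; suff : lint setT h = +oo%E by move=> H; rewrite H in hfin.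
  apply: (@lint_infty R h 1 p (h p)) => //; first by left.
  move=> x xp; apply: Und; first by lra.
  by apply: contrapT => nUx; apply: allU; exists x.
pose z0 := sup U.
have uh : unimodal_on_sides z0 h.
  move=> s x y [->|->] sx sxy.
    have [<-//|xy] := eqVneq x y.
    apply: nU; last by rewrite lt_neqAle xy; lra.
    by move=> Ux; have := ub_le_sup Uub Ux; rewrite -/z0; lra.
  apply: Und; first by lra.
  have [u Uu xu] : exists2 u, U u & x < u.
    by apply: sup_gt => //; rewrite -/z0; lra.
  exact: Udown Uu (ltW xu).
have [B1 B10 HB1] := log_concave_side_bounded h z0 1 lh uh (or_introl erefl).
have [B2 B20 HB2] := log_concave_side_bounded h z0 (-1) lh uh (or_intror erefl).
exists z0, (Num.max (h z0) (Num.max B1 B2)); split => // x.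
rewrite h0/= !le_max; have [xz|zx|->] := ltgtP x z0; last by rewrite lexx.
  by rewrite HB2 ?orbT//; lra.
by rewrite HB1 ?orbT//; lra.
Qed.

Lemma log_concaveZ {R : realType} (h : R -> R) k :
  0 <= k -> log_concave h -> log_concave (fun x => k * h x).
Proof.
move=> k0 [h0 lh]; split=> [x|x y s s01]; first exact: mulr_ge0.
rewrite !powRM// mulrACA.
have -> : k `^ s * k `^ (1 - s) = k.
  have [->|kn0] := eqVneq k 0; first by rewrite powR0 ?mul0r//; lra.
  by rewrite -powRD ?kn0 ?implybT// [s + _]addrC subrK powRr1.
by rewrite ler_wpM2l// lh.
Qed.

(** * The sup-convolution and its log-concavity *)

Lemma sup_powR_le {R : realType} (A : set R) (s c C : R) :
  A !=set0 -> (forall a, A a -> 0 <= a) -> 0 < s -> 0 <= c -> 0 <= C ->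
  (forall a, A a -> a `^ s * c <= C) -> sup A `^ s * c <= C.
Proof.
move=> A0 Age0 s0 c0 C0 AC.
have [->|cn0] := eqVneq c 0; first by rewrite mulr0.
have c_gt0 : 0 < c by rewrite lt_neqAle eq_sym cn0.
(* Inverting the power gives an upper bound of [A], so that [sup] is a genuine supremum. *)
have Aub : ubound A ((C / c) `^ s^-1).
  move=> a Aa; have := AC a Aa; rewrite -ler_pdivlMr// => H.
  have -> : a = (a `^ s) `^ s^-1.
    by rewrite -powRrM divff ?gt_eqF// powRr1// Age0.
  apply: ge0_ler_powR => //; rewrite ?nnegrE ?invr_ge0 ?powR_ge0 ?divr_ge0//.
  exact: ltW.
have supA : sup A <= (C / c) `^ s^-1 by exact: ge_sup.
have supA0 : 0 <= sup A.
  have [a Aa] := A0; apply: le_trans (Age0 a Aa) _.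
  by apply: ub_le_sup => //; exists ((C / c) `^ s^-1).
rewrite -ler_pdivlMr//.
have -> : C / c = ((C / c) `^ s^-1) `^ s.
  by rewrite -powRrM mulVf ?gt_eqF// powRr1// divr_ge0.
by apply: ge0_ler_powR; rewrite ?nnegrE ?powR_ge0//; exact: ltW.
Qed.

(** The supremum over [l x + m y = z], with [y] eliminated. As [sup] has a default value on
    unbounded sets, the section below works under a majorant [h]. *)
Definition sup_convolution {R : realType} (l m : R) (f g : R -> R) (z : R) : R :=
  sup [set f x `^ l * g ((z - l * x) / m) `^ m | x in [set: R]].

Section SupConvolution.
Context {R : realType} (l m : R) (f g h : R -> R).
Context (l0 : 0 < l) (m0 : 0 < m).
Context (fgh : forall x y, f x `^ l * g y `^ m <= h (l * x + m * y)).

Let A z := [set f x `^ l * g ((z - l * x) / m) `^ m | x in [set: R]].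

Lemma sup_convolution_ub z : ubound (A z) (h z).
Proof.
move=> _ [x _ <-]; apply: le_trans (fgh _ _) _.
have -> // : l * x + m * ((z - l * x) / m) = z.
by field; rewrite gt_eqF.
Qed.

Lemma sup_convolution_le z : sup_convolution l m f g z <= h z.
Proof.
apply: ge_sup; last exact: sup_convolution_ub.
by exists (f 0 `^ l * g ((z - l * 0) / m) `^ m); exists 0.
Qed.

Lemma le_sup_convolution x y :
  f x `^ l * g y `^ m <= sup_convolution l m f g (l * x + m * y).
Proof.
apply: ub_le_sup.
  by exists (h (l * x + m * y)); exact: sup_convolution_ub.
exists x => //; congr (_ * g _ `^ _).
by field; rewrite gt_eqF.
Qed.

(** Take arbitrary competitors for [z1] and [z2]; their convex combination competes at the
    intermediate point, and log-concavity of [f] and [g] compares the values. [sup_powR_le] then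
    passes to the two suprema one at a time. *)
Lemma log_concave_sup_convolution :
  log_concave f -> log_concave g -> log_concave (sup_convolution l m f g).
Proof.
move=> [f0 lf] [g0 lg].
have A0 z : A z !=set0.
  by exists (f 0 `^ l * g ((z - l * 0) / m) `^ m); exists 0.
have Age0 z a : A z a -> 0 <= a by move=> [x _ <-]; rewrite mulr_ge0 ?powR_ge0.
have sc0 z : 0 <= sup_convolution l m f g z.
  have [a Aa] := A0 z; apply: le_trans (Age0 z a Aa) _.
  by apply: ub_le_sup => //; exists (h z); exact: sup_convolution_ub.
split=> // z1 z2 s s01.
have [s0 s1] : 0 < s /\ 0 < 1 - s by lra.
apply: (sup_powR_le (A z1)); rewrite ?powR_ge0//; first exact: Age0.
move=> a1 Aa1; rewrite mulrC; apply: (sup_powR_le (A z2)); rewrite ?powR_ge0//.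
  exact: Age0.
move=> a2 Aa2; rewrite mulrC.
case: Aa1 => x1 _ <-; case: Aa2 => x2 _ <-.
set y1 := (z1 - _) / m; set y2 := (z2 - _) / m.
have -> : s * z1 + (1 - s) * z2 =
    l * (s * x1 + (1 - s) * x2) + m * (s * y1 + (1 - s) * y2).
  by rewrite /y1 /y2; field; rewrite gt_eqF.
apply: le_trans (le_sup_convolution _ _).
rewrite !powRM ?powR_ge0// -!powRrM mulrACA.
have H (u : R -> R) r x y : 0 < r -> log_concave u ->
    u x `^ (r * s) * u y `^ (r * (1 - s)) <= u (s * x + (1 - s) * y) `^ r.
  move=> r0 [u0 lu]; rewrite ![r * _]mulrC !powRrM -powRM ?powR_ge0//.
  apply: ge0_ler_powR; rewrite ?nnegrE ?mulr_ge0 ?powR_ge0// ?lu//.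
  exact: ltW.
by apply: ler_pM; rewrite ?mulr_ge0 ?powR_ge0//; exact: H.
Qed.

End SupConvolution.

(** Dividing [f], [g], [h] by [F], [G] and [P = F^l G^m] reduces to unit masses. Undoing this
    multiplies [h] by [F / P] and [G / P], which are powers of [G / F]. *)
Lemma prekopa_leindler_stability_log_concave {R : realType} (l m t e F G : R)
    (f g h : R -> R) :
  0 < l -> 0 < m -> l + m = 1 -> 0 < t -> t <= l -> t <= m -> 0 < e -> e <= t ->
  lebesgue_measurable f -> lebesgue_measurable g ->
  (forall x, 0 <= f x) -> (forall x, 0 <= g x) -> log_concave h ->
  0 < F -> 0 < G -> lint setT f = F%:E -> lint setT g = G%:E ->
  (lint setT h <= ((1 + e) * (F `^ l * G `^ m))%:E)%E ->
  (forall x y, f x `^ l * g y `^ m <= h (l * x + m * y)) ->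
  (((1 - e) * (F `^ l * G `^ m))%:E <= lint setT h)%E /\
  exists x0,
    (lint setT (fun x => `|f x - (G / F) `^ (- m) * h (x + m * x0)|)%R <=
       (35 * Num.sqrt (e / t) * F)%:E)%E /\
    (lint setT (fun x => `|g x - (G / F) `^ l * h (x - l * x0)|)%R <=
       (35 * Num.sqrt (e / t) * G)%:E)%E.
Proof.
move=> l0 m0 lm t0 tl tm e0 et mf mg f0 g0 lh F0 G0 fF gG hP fgh.
have [h0 _] := lh.
set P := F `^ l * G `^ m in hP *.
have P0 : 0 < P by rewrite mulr_gt0// powR_gt0.
have qh := log_concave_quasi _ lh.
have bh : measurable_fun [set: measurableTypeR R] h.
  exact: quasi_concave_measurable.
have mh : lebesgue_measurable h by exact: borel_lebesgue_measurable.
have exists_pos (u : R -> R) U : 0 < U -> (forall x, 0 <= u x) ->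
    lint setT u = U%:E -> exists x, 0 < u x.
  move=> U0 u0 uU; apply: contrapT => npos.
  have : lint setT u = 0%E.
    rewrite -(@lint0 R setT); apply: eq_lint => x _; apply/eqP.
    rewrite eq_le u0 andbT leNgt; apply/negP => ux; apply: npos; by exists x.
  by rewrite uU => -[UE]; rewrite UE ltxx in U0.
have [xf fxf] := exists_pos f F F0 f0 fF.
have [yg gyg] := exists_pos g G G0 g0 gG.
pose f' x := F^-1 * f x; pose g' x := G^-1 * g x; pose h' x := P^-1 * h x.
have lh' : log_concave h' by apply: log_concaveZ => //; rewrite invr_ge0 ltW.
have hp : 0 < h' (l * xf + m * yg).
  rewrite mulr_gt0 ?invr_gt0//; apply: lt_le_trans (fgh _ _).
  by rewrite mulr_gt0// powR_gt0.
have h'1 : (lint setT h' <= (1 + e)%:E)%E.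
  rewrite lintZ//; [|exact: lset_setT|by rewrite invr_ge0 ltW].
  apply: (@le_trans _ _ (P^-1%:E * ((1 + e) * P)%:E)%E).
    by rewrite lee_pmul2l// lte_fin invr_gt0.
  by rewrite -EFinM lee_fin mulrC mulfK// gt_eqF.
have h'fin : (lint setT h' < +oo)%E by apply: le_lt_trans h'1 (ltry _).
have [z0 [B [hB uh]]] := log_concave_unimodal h' _ lh' hp h'fin.
have qh' := log_concave_quasi _ lh'.
have h'0 x : 0 <= h' x by case/andP: (hB x).
have f'1 : lint setT f' = 1%:E.
  rewrite lintZ//; [|exact: lset_setT|by rewrite invr_ge0 ltW].
  by rewrite fF -EFinM mulVf// gt_eqF.
have g'1 : lint setT g' = 1%:E.
  rewrite lintZ//; [|exact: lset_setT|by rewrite invr_ge0 ltW].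
  by rewrite gG -EFinM mulVf// gt_eqF.
have [] := prekopa_leindler_stability_unimodal l m t e B z0 f' g' h' l0 m0 lm t0
  tl tm e0 et (lebesgue_measurableZ _ _ mf) (lebesgue_measurableZ _ _ mg) _ _ hB
  f'1 g'1 h'1 _ _ uh _.
- by move=> x; rewrite mulr_ge0// invr_ge0 ltW.
- by move=> x; rewrite mulr_ge0// invr_ge0 ltW.
- move=> c; apply: borel_lebesgue_measurable; apply: quasi_concave_measurable.
  exact: quasi_concave_shift.
- move=> c; apply: lebesgue_integral_shift => //.
  exact: quasi_concave_measurable.
- move=> x y; rewrite /f' /g' /h' !powRM ?invr_ge0 ?(ltW F0) ?(ltW G0)//.
  rewrite mulrACA [leLHS](_ : _ = P^-1 * (f x `^ l * g y `^ m)).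
    by rewrite ler_wpM2l// invr_ge0 ltW.
  congr (_ * _); rewrite /P invfM -[F^-1]powR_inv1 ?(ltW F0)//.
  by rewrite -[G^-1]powR_inv1 ?(ltW G0)// -!powRrM !mulN1r !powRN.
move=> h'_ge [x0 [y0 [xyz Hf Hg]]].
have hPE : lint setT h = (P%:E * lint setT h')%E.
  rewrite lintZ//; [|exact: lset_setT|by rewrite invr_ge0 ltW].
  by rewrite muleA -EFinM divff ?gt_eqF// mul1e.
split.
  by rewrite hPE [X in (X%:E <= _)%E]mulrC EFinM lee_pmul2l ?lte_fin.
have aF : P * (G / F) `^ (- m) = F.
  rewrite /P powRM ?invr_ge0 ?(ltW F0) ?(ltW G0)// -powR_inv1 ?(ltW F0)//.
  rewrite -powRrM [G `^ (- m) * _]mulrC mulrACA -!powRD ?(gt_eqF F0) ?(gt_eqF G0) ?implybT//.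
  by rewrite subrr powRr0 mulr1 mulN1r opprK lm powRr1// ltW.
have aG : P * (G / F) `^ l = G.
  rewrite /P powRM ?invr_ge0 ?(ltW F0) ?(ltW G0)// -powR_inv1 ?(ltW F0)//.
  rewrite -powRrM [_ `^ l * F `^ _]mulrC mulrACA -!powRD ?(gt_eqF F0) ?(gt_eqF G0) ?implybT//.
  by rewrite mulN1r subrr powRr0 mul1r addrC lm powRr1// ltW.
have rescale (u : R -> R) U k c : 0 < U -> P * k = U -> lebesgue_measurable u ->
    (lint setT (fun x => `|U^-1 * u x - h' (x + c)|)%R <=
       (35 * Num.sqrt (e / t))%:E)%E ->
    (lint setT (fun x => `|u x - k * h (x + c)|)%R <=
       (35 * Num.sqrt (e / t) * U)%:E)%E.
  move=> U0 kU mu H.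
  rewrite (@eq_lint R _ _ (fun x => U * `|U^-1 * u x - h' (x + c)|)); last first.
    move=> x _; rewrite -{1}(gtr0_norm U0) -normrM; congr `|_|.
    rewrite /h' mulrBr !mulrA divff ?gt_eqF// mul1r -kU [P * k]mulrC.
    by rewrite mulfK// gt_eqF.
  rewrite lintZ//; last 3 first.
  - exact: lset_setT.
  - apply: lebesgue_measurable_norm; apply: lebesgue_measurableB.
      exact: lebesgue_measurableZ.
    apply: borel_lebesgue_measurable; apply: quasi_concave_measurable.
    exact: quasi_concave_shift.
  - exact: ltW.
  by rewrite mulrC EFinM lee_pmul2l ?lte_fin.
(* From [l x0 + m y0 = z0] the two shifts are [z0 - x0 = m (y0 - x0)] and
   [z0 - y0 = - l (y0 - x0)]. *)
exists (y0 - x0); split.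
- have mxy : m * (y0 - x0) = z0 - x0.
    by rewrite -xyz (_ : l = 1 - m); [ring|lra].
  by rewrite mxy; apply: rescale.
- have -> : (fun x => `|g x - (G / F) `^ l * h (x - l * (y0 - x0))|) =
      (fun x => `|g x - (G / F) `^ l * h (x + (z0 - y0))|).
    apply/funext => x; congr (`|_ - _ * h _|).
    by rewrite -xyz (_ : m = 1 - l); [ring|lra].
  exact: rescale.
Qed.

Lemma log_concave0 {R : realType} : log_concave (fun=> 0 : R).
Proof.
split=> // x y s s01; rewrite powR0 ?mul0r//; lra.
Qed.

Lemma prekopa_leindler_stability {R : realType} (lam eps : R) (f g h : R -> R) :
  0 < lam < 1 -> 0 < eps ->
  prekopa_leindler_near_equality lam eps f g h ->
  log_concave h \/ (log_concave f /\ log_concave g) ->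
  exists (a x0 : R) (ht : R -> R),
    [/\ 0 < a, log_concave ht &
      let K := 100 * Num.sqrt (eps / Num.min lam (1 - lam)) in
      [/\ (lebesgue_integral (fun x =>
             `|f x - a `^ (- (1 - lam)) * ht (x + (1 - lam) * x0)|)%R
           <= K%:E * lebesgue_integral f)%E,
          (lebesgue_integral (fun x =>
             `|g x - a `^ lam * ht (x - lam * x0)|)%R
           <= K%:E * lebesgue_integral g)%E
        & (lebesgue_integral (fun x => `|h x - ht x|)%R
           <= K%:E * lebesgue_integral h)%E]].
Proof.
move=> /andP[l0 l1] e0 [[f0 g0 h0] [mf mg mh] [/andP[fpos ffin] /andP[gpos gfin]]].
move=> fgh hle lc.
set t := Num.min lam (1 - lam).
have m0 : 0 < 1 - lam by lra.
have lm : lam + (1 - lam) = 1 by lra.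
have t0 : 0 < t by rewrite lt_min l0.
have tl : t <= lam by rewrite ge_min lexx.
have tm : t <= 1 - lam by rewrite ge_min lexx orbT.
have mT : lset [set: R] by exact: lset_setT.
set d := Num.sqrt (eps / t).
have d0 : 0 < d by rewrite sqrtr_gt0 divr_gt0.
(* For [t <= eps] the zero function has relative error 1, below the allowed [100 * d]. *)
have [te|et] := leP t eps.
  exists 1, 0, (fun=> 0); split; [by []|exact: log_concave0|].
  have K1 : 1 <= 100 * d.
    have : 1 <= d by rewrite -[leLHS]sqrtr1 ler_sqrt ?divr_ge0 ?(ltW e0) ?(ltW t0)//
      ler_pdivlMr// mul1r.
    by lra.
  have zero (u : R -> R) k : (forall x, 0 <= u x) ->
      (lint setT (fun x => `|u x - k * 0|)%R <= (100 * d)%:E * lint setT u)%E.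
    move=> u0; rewrite (@eq_lint _ _ _ u); last first.
      by move=> x _; rewrite mulr0 subr0 ger0_norm.
    by apply: lee_pemull; [exact: lint_ge0|rewrite lee_fin].
  split; [exact: zero|exact: zero|].
  have := zero h 1 h0; congr (_ <= _)%E.
  by apply: eq_lint => x _; rewrite mulr0.
pose F := fine (lint setT f); pose G := fine (lint setT g).
have fF : lint setT f = F%:E.
  by rewrite /F fineK// ge0_fin_numE ?lint_ge0.
have gG : lint setT g = G%:E.
  by rewrite /G fineK// ge0_fin_numE ?lint_ge0.
have F0 : 0 < F by rewrite -lte_fin -fF.
have G0 : 0 < G by rewrite -lte_fin -gG.
set P := F `^ lam * G `^ (1 - lam).
have P0 : 0 < P by rewrite mulr_gt0// powR_gt0.
have hP : (lint setT h <= ((1 + eps) * P)%:E)%E.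
  move: hle; rewrite -/(lint setT h) -[lebesgue_integral f]/(lint setT f).
  by rewrite -[lebesgue_integral g]/(lint setT g) fF gG !poweR_EFin -!EFinM.
have [hh [lhh hhle hhPL]] : exists hh : R -> R, [/\ log_concave hh,
    forall x, hh x <= h x &
    forall x y, f x `^ lam * g y `^ (1 - lam) <= hh (lam * x + (1 - lam) * y)].
  case: lc => [lh|[lf lg]]; first by exists h.
  exists (sup_convolution lam (1 - lam) f g); split.
  - exact: (log_concave_sup_convolution _ _ _ _ h).
  - exact: sup_convolution_le.
  - exact: (le_sup_convolution _ _ _ _ h).
have [hh0 _] := lhh.
have mhh : lebesgue_measurable hh.
  apply: borel_lebesgue_measurable; apply: quasi_concave_measurable.
  exact: log_concave_quasi.
have hhP : (lint setT hh <= ((1 + eps) * P)%:E)%E.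
  by apply: le_trans hP; apply: lint_le.
have [hh_ge [x0 [Hf Hg]]] := prekopa_leindler_stability_log_concave lam (1 - lam) t
  eps F G f g hh l0 m0 lm t0 tl tm e0 (ltW et) mf mg f0 g0 lhh F0 G0 fF gG hhP hhPL.
exists (G / F), x0, hh; split; [exact: divr_gt0|exact: lhh|].
rewrite -[lebesgue_integral f]/(lint setT f) -[lebesgue_integral g]/(lint setT g).
move=> K; rewrite fF gG -!EFinM /K {K} -/t -/d; split.
- by apply: le_trans Hf _; rewrite lee_fin ler_pM2r// ler_pM2r//; lra.
- by apply: le_trans Hg _; rewrite lee_fin ler_pM2r// ler_pM2r//; lra.
pose r := fine (lint setT hh); pose w := fine (lint setT h).
have hhE : lint setT hh = r%:E.
  by rewrite /r fineK// ge0_fin_numE ?lint_ge0//; apply: le_lt_trans hhP (ltry _).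
have hE : lint setT h = w%:E.
  by rewrite /w fineK// ge0_fin_numE ?lint_ge0//; apply: le_lt_trans hP (ltry _).
have mn : lebesgue_measurable (fun x => `|h x - hh x|).
  by apply: lebesgue_measurable_norm; exact: lebesgue_measurableB.
(* As [hh <= h], the distance is the difference of masses. It is at most [2 eps P], where [eps <= d]
   and [P <= 2 w]. *)
have E : (lint setT (fun x => `|h x - hh x|)%R + r%:E = w%:E)%E.
  rewrite -hhE -hE -lintD//; apply: eq_lint => x _.
  by rewrite ger0_norm ?subr_ge0// subrK.
rewrite -[leLHS]/(lint setT _) -[lebesgue_integral h]/(lint setT h).
rewrite -(@leeD2rE _ r%:E)// E hE -EFinM -EFinD lee_fin.
move: hP hh_ge hhP; rewrite hE hhE !lee_fin -/d -/P => wP rP _.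
have rw : r <= w by rewrite -lee_fin -hhE -hE; apply: lint_le.
have e2 : eps <= 1 / 2 by lra.
have wP2 : P / 2 <= w.
  by apply: le_trans rw; apply: le_trans rP; rewrite mulrC ler_pM2r//; lra.
have ed : eps <= d.
  have dE : d ^+ 2 = eps / t by rewrite sqr_sqrtr// divr_ge0// ltW.
  have d1 : d <= 1.
    by rewrite -[leRHS]sqrtr1 ler_sqrt// ler_pdivrMr// mul1r ltW.
  apply: (@le_trans _ _ (eps / t)).
    by rewrite ler_peMr ?(ltW e0)// invf_ge1//; lra.
  by rewrite -dE expr2 ler_piMr// ltW.
have H1 : eps * P <= d * P by rewrite ler_pM2r.
have H2 : d * (P / 2) <= d * w by rewrite ler_pM2l.
move: wP rP H1 H2 => wP rP H1 H2; nra.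
Qed.

(** * Sharpness *)

Definition box {R : realType} (c L x : R) : R := c * (0 <= x <= L)%R%:R.

Lemma box_ge0 {R : realType} (c L x : R) : 0 <= c -> 0 <= box c L x.
Proof. by move=> c0; rewrite mulr_ge0. Qed.

Lemma log_concave_box {R : realType} (c L : R) :
  0 <= c -> log_concave (box c L).
Proof.
move=> c0; apply: log_concaveZ => //; split=> [x|x y s s01]; first exact: ler0n.
have [s0 s1] : s != 0 /\ 1 - s != 0 by split; lra.
case: (boolP (0 <= x <= L)) => [/andP[x0 xL]|_]; last first.
  by rewrite powR0 ?mul0r.
case: (boolP (0 <= y <= L)) => [/andP[y0 yL]|_]; last first.
  by rewrite powR0 ?mulr0.
rewrite !powR1 mulr1; have -> // : 0 <= s * x + (1 - s) * y <= L.
by apply/andP; split; nra.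
Qed.

Lemma lint_box {R : realType} (c L : R) :
  0 <= c -> 0 <= L -> lint setT (box c L) = (c * L)%:E.
Proof.
move=> c0 L0.
have mb : lebesgue_measurable (box c L).
  apply: borel_lebesgue_measurable; apply: quasi_concave_measurable.
  by apply: log_concave_quasi; exact: log_concave_box.
rewrite (@lint_two_sides _ 0 L 0)//; last by move=> x; exact: box_ge0.
rewrite (@eq_lint _ [set y | (y < 0 - 0)%R] _ (fun=> 0)); last first.
  by move=> x /=; rewrite subr0 /box leNgt => ->; rewrite mulr0.
rewrite (@eq_lint _ (cell 1 0 0 L) _ (fun=> c)); last first.
  move=> x; rewrite /cell/= mul1r subr0 /box => /andP[x0 xL].
  by rewrite (ltW x0) xL mulr1.
rewrite (@eq_lint _ [set y | (0 + L < y)%R] _ (fun=> 0)); last first.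
  by move=> x /=; rewrite add0r /box (leNgt x) => ->; rewrite andbF mulr0.
rewrite (@lint_null _ (cell (-1) 0 0 0))//; last by rewrite cell_measure ?subrr//; right.
rewrite !lint0 lint_cst// cell_measure//; last by left.
by rewrite !add0e adde0 subr0 EFinM.
Qed.

(** The right side lives on the Minkowski combination of [[0, 1]] and [[0, 1 + s]] with weights [l]
    and [m]; its height is the geometric mean of the heights. *)
Lemma box_prekopa_leindler {R : realType} (l m s x y : R) :
  0 < l -> 0 < m -> l + m = 1 -> 0 < s ->
  box 1 1 x `^ l * box (1 + s)^-1 (1 + s) y `^ m <=
  box ((1 + s) `^ (- m)) (1 + m * s) (l * x + m * y).
Proof.
move=> l0 m0 lm s0.
have h0 : 0 <= box ((1 + s) `^ (- m)) (1 + m * s) (l * x + m * y).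
  by apply: box_ge0; exact: powR_ge0.
case: (boolP (0 <= x <= 1)) => [/andP[x0 x1]|/negPf nx]; last first.
  by rewrite {1}/box nx mulr0 powR0 ?mul0r// gt_eqF.
case: (boolP (0 <= y <= 1 + s)) => [/andP[y0 y1]|/negPf ny]; last first.
  by rewrite {2}/box ny mulr0 [0 `^ m]powR0 ?mulr0// gt_eqF.
rewrite /box x0 x1 y0 y1/= !mulr1 powR1 mul1r.
have -> : 0 <= l * x + m * y <= 1 + m * s.
  apply/andP; split; first by rewrite addr_ge0// mulr_ge0// ltW.
  have : l * x <= l by rewrite ler_piMr// ltW.
  have : m * y <= m * (1 + s) by rewrite ler_pM2l.
  lra.
rewrite mulr1 -powR_inv1; last by lra.
by rewrite -powRrM mulN1r.
Qed.

(** Multiplied by [1 + s = (1 + s)^m (1 + s)^l], the left side is at most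
    [(1 + m s)(1 + l s) = 1 + s + l m s^2], so the excess is of second order in [s]. *)
Lemma box_mass_le {R : realType} (l m t e s : R) :
  0 < l -> 0 < m -> l + m = 1 -> l * m <= t -> 0 < s -> t * s ^+ 2 = e ->
  (1 + s) `^ (- m) * (1 + m * s) <= 1 + e.
Proof.
move=> l0 m0 lm lmt s0 tsE.
have s1 : 0 < 1 + s by lra.
have H1 : (1 + s) `^ l <= 1 + l * s.
  have := @weighted_am_gm R l m (1 + s) 1 l0 m0 lm (ltW s1) ler01.
  by rewrite powR1 mulr1; lra.
have H2 : (1 + s) `^ m * (1 + s) `^ l = 1 + s.
  by rewrite -powRD ?(gt_eqF s1) ?implybT// [m + l]addrC lm powRr1// ltW.
have pm := powR_gt0 m s1; have pl := powR_gt0 l s1.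
rewrite powRN mulrC ler_pdivrMr// -(ler_pM2r pl) -mulrA H2.
apply: (@le_trans _ _ ((1 + m * s) * (1 + l * s))).
  by rewrite ler_pM2l//; apply: addr_gt0 => //; exact: mulr_gt0.
have lms : l * m * s ^+ 2 <= e by rewrite -tsE ler_wpM2r// sqr_ge0.
have e0 : 0 <= e.
  by apply: le_trans lms; rewrite mulr_ge0 ?sqr_ge0// mulr_ge0// ltW.
have es : 0 <= e * s by rewrite mulr_ge0// ltW.
have -> : (1 + m * s) * (1 + l * s) = 1 + (l + m) * s + l * m * s ^+ 2 by ring.
by rewrite lm; lra.
Qed.

(* Here r bounds both distances: shifting the second one makes a * f r(1 + a)-close
   to a translate of g, which forces a <= 1 + (1 + a) r by comparing masses, and
   1 - 1 / (1 + s) <= (1 + a) r since f has smaller support than g. *)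
Lemma box_far {R : realType} (s a x0 r : R) (u : R -> R) :
  0 < s -> s <= 1 -> 0 < a -> 0 <= r -> r <= s / 10 ->
  quasi_concave u -> (forall x, 0 <= u x) ->
  (lint setT (fun x => `|box 1 1 x - u x|)%R < r%:E)%E ->
  ~ (lint setT (fun x => `|box (1 + s)^-1 (1 + s) x - a * u (x - x0)|)%R < r%:E)%E.
Proof.
move=> s0 s1 a0 r0 rs qu u0 Hf Hg.
set f := box 1 1 in Hf *; set g := box _ _ in Hg *.
have s1gt0 : 0 < 1 + s by lra.
have w0 : 0 <= (1 + s)^-1 by rewrite invr_ge0 ltW.
have qf : quasi_concave f by apply: log_concave_quasi; exact: log_concave_box.
have qg : quasi_concave g by apply: log_concave_quasi; exact: log_concave_box.
have bqc c (v : R -> R) : quasi_concave v ->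
    measurable_fun [set: measurableTypeR R] (fun x => v (x + c)).
  by move=> qv; apply: quasi_concave_measurable; exact: quasi_concave_shift.
have mqc c (v : R -> R) : quasi_concave v -> lebesgue_measurable (fun x => v (x + c)).
  by move=> qv; apply: borel_lebesgue_measurable; exact: bqc.
have mf : lebesgue_measurable f.
  by apply: borel_lebesgue_measurable; exact: quasi_concave_measurable.
have mu : lebesgue_measurable u.
  by apply: borel_lebesgue_measurable; exact: quasi_concave_measurable.
pose g1 x := g (x + x0).
have mg1 : lebesgue_measurable g1 by exact: mqc.
have f0 x : 0 <= f x by exact: box_ge0.
have g0 x : 0 <= g x by exact: box_ge0.
have g10 x : 0 <= g1 x by exact: g0.
have mT : lset [set: R] by exact: lset_setT.
have f1 : lint setT f = 1%:E by rewrite lint_box ?mulr1.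
have g1E : lint setT g1 = 1%:E.
  rewrite -[LHS]/(lebesgue_integral _) lebesgue_integral_shift//.
    by rewrite -[LHS]/(lint setT g) lint_box ?mulVf ?gt_eqF// ltW.
  exact: quasi_concave_measurable.
have {}Hg : (lint setT (fun x => `|g1 x - a * u x|)%R < r%:E)%E.
  have E : lebesgue_integral (fun x => `|g (x + x0) - a * u (x + x0 - x0)|) =
      lebesgue_integral (fun x => `|g x - a * u (x - x0)|).
    apply: (@lebesgue_integral_shift R (fun x => `|g x - a * u (x - x0)|) x0) => //.
    apply: measurableT_comp => //; apply: measurable_funB.
      exact: quasi_concave_measurable.
    by apply: measurable_funM => //; exact: bqc.
  move: Hg; rewrite -[lint setT _]/(lebesgue_integral _) -E.
  by rewrite (_ : (fun x => _) = (fun x => `|g1 x - a * u x|))//;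
    apply/funext => x; rewrite addrK.
pose D x := `|a * f x - g1 x|.
have maf : lebesgue_measurable (fun x => a * f x) by exact: lebesgue_measurableZ.
have mau : lebesgue_measurable (fun x => a * u x) by exact: lebesgue_measurableZ.
have mD : lebesgue_measurable D.
  by apply: lebesgue_measurable_norm; exact: lebesgue_measurableB.
have mfu : lebesgue_measurable (fun x => `|f x - u x|).
  by apply: lebesgue_measurable_norm; exact: lebesgue_measurableB.
have mgu : lebesgue_measurable (fun x => `|g1 x - a * u x|).
  by apply: lebesgue_measurable_norm; exact: lebesgue_measurableB.
have mafu : lebesgue_measurable (fun x => a * `|f x - u x|).
  exact: lebesgue_measurableZ.
have D0 x : 0 <= D x by exact: normr_ge0.
have Dr : (lint setT D <= ((1 + a) * r)%:E)%E.
  apply: (@le_trans _ _ (lint setT (fun x => a * `|f x - u x| + `|g1 x - a * u x|)%R)).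
    apply: lint_le => //; first exact: lebesgue_measurableD.
    move=> x _; rewrite /D -{2}(gtr0_norm a0) -normrM mulrBr.
    rewrite [X in _ <= _ + X]distrC.
    have -> : a * f x - g1 x = (a * f x - a * u x) + (a * u x - g1 x) by ring.
    exact: ler_normD.
  rewrite lintD//; last by move=> x _; rewrite mulr_ge0// ltW.
  rewrite lintZ//; last exact: ltW.
  rewrite mulrDl mul1r addrC EFinD; apply: leeD; first exact: ltW.
  by rewrite EFinM lee_pmul2l ?lte_fin//; exact: ltW.
(* Off the support of [f], [D] equals [g1]; on it, [g1] is at most its height [(1 + s)^-1]. *)
have wf_ge : (1 <= (1 + a) * r + (1 + s)^-1).
  have mwf : lebesgue_measurable (fun x => (1 + s)^-1 * f x).
    exact: lebesgue_measurableZ.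
  have : (lint setT g1 <= lint setT (fun x => D x + (1 + s)^-1 * f x)%R)%E.
    apply: lint_le => //; first exact: lebesgue_measurableD.
    move=> x _; rewrite /D /f /box mul1r.
    case: (0 <= x <= 1); rewrite ?mulr1 ?mulr0 ?addr0 ?sub0r ?normrN; last first.
      exact: ler_norm.
    by rewrite -[leLHS]add0r lerD// /g1 /g /box ler_piMr// lern1 leq_b1.
  rewrite lintD//; last by move=> x _; rewrite mulr_ge0.
  rewrite (@lintZ _ setT (1 + s)^-1 f)// f1 g1E mule1 => H.
  by have := le_trans H (leeD Dr (lexx _)); rewrite -EFinD lee_fin.
have a_le : a <= 1 + (1 + a) * r.
  have : (lint setT (fun x => a * f x)%R <= lint setT (fun x => g1 x + D x)%R)%E.
    apply: lint_le => //.
    - exact: lebesgue_measurableD.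
    - by move=> x _; rewrite mulr_ge0// ltW.
    - by move=> x _; rewrite /D -lerBlDl ler_norm.
  rewrite lintD// (@lintZ _ setT a f)//; last exact: ltW.
  rewrite f1 g1E mule1 => H.
  by have := le_trans H (leeD (lexx _) Dr); rewrite -EFinD lee_fin.
have ws : s / 2 <= 1 - (1 + s)^-1.
  have -> : 1 - (1 + s)^-1 = s / (1 + s) by field; rewrite gt_eqF.
  by rewrite ler_pM2l// lef_pV2 ?posrE//; lra.
(* [wf_ge] forces [1 + a >= 5], while [a_le] with [s <= 1] gives [1 + a <= 20/9]. *)
have H1 : (1 + a) * r <= (1 + a) * (s / 10) by rewrite ler_pM2l//; lra.
have H2 : (1 + a) * (s / 10) <= (1 + a) / 10.
  by rewrite ler_pM2l ?ler_pM2r//; lra.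
have H3 : 1 / 2 <= (1 + a) / 10.
  rewrite -(ler_pM2l s0); lra.
lra.
Qed.

Lemma prekopa_leindler_stability_sharp {R : realType} (lam eps : R) :
  0 < lam < 1 -> 0 < eps <= Num.min lam (1 - lam) ->
  exists f g h : R -> R,
    [/\ prekopa_leindler_near_equality lam eps f g h,
        log_concave h \/ (log_concave f /\ log_concave g) &
      forall (a x0 : R) (ht : R -> R), 0 < a -> log_concave ht ->
        let K := 1 / 10 * Num.sqrt (eps / Num.min lam (1 - lam)) in
        [\/ (K%:E * lebesgue_integral f <=
             lebesgue_integral (fun x =>
               `|f x - a `^ (- (1 - lam)) * ht (x + (1 - lam) * x0)|)%R)%E,
            (K%:E * lebesgue_integral g <=
             lebesgue_integral (fun x =>
               `|g x - a `^ lam * ht (x - lam * x0)|)%R)%E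
          | (K%:E * lebesgue_integral h <=
             lebesgue_integral (fun x => `|h x - ht x|)%R)%E]].
Proof.
move=> /andP[l0 l1] /andP[e0 et].
set t := Num.min lam (1 - lam) in et *.
set m := 1 - lam.
have m0 : 0 < m by rewrite subr_gt0.
have lm : lam + m = 1 by rewrite /m; ring.
have t0 : 0 < t by rewrite lt_min l0.
set s := Num.sqrt (eps / t).
have s0 : 0 < s by rewrite sqrtr_gt0 divr_gt0.
have sE : s ^+ 2 = eps / t by rewrite sqr_sqrtr// divr_ge0// ltW.
have tsE : t * s ^+ 2 = eps by rewrite sE mulrC divfK// gt_eqF.
have s1 : s <= 1.
  by rewrite -[leRHS]sqrtr1 ler_sqrt// ler_pdivrMr// mul1r.
have lmt : lam * m <= t.
  rewrite le_min; apply/andP; split.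
    by rewrite ler_piMr// /m; lra.
  by rewrite ler_piMl//; lra.
have s1gt0 : 0 < 1 + s by lra.
have w0 : 0 <= (1 + s)^-1 by rewrite invr_ge0 ltW.
have mb c L : 0 <= c -> lebesgue_measurable (box c L).
  move=> c0; apply: borel_lebesgue_measurable; apply: quasi_concave_measurable.
  by apply: log_concave_quasi; exact: log_concave_box.
pose f : R -> R := box 1 1.
pose g : R -> R := box (1 + s)^-1 (1 + s).
pose h : R -> R := box ((1 + s) `^ (- m)) (1 + m * s).
have f1 : lebesgue_integral f = 1%:E.
  by rewrite -[LHS]/(lint setT f) lint_box ?mulr1.
have g1 : lebesgue_integral g = 1%:E.
  by rewrite -[LHS]/(lint setT g) lint_box ?mulVf ?gt_eqF// ltW.
exists f, g, h; split.
- split.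
  + by split=> x; apply: box_ge0 => //; exact: powR_ge0.
  + by split; apply: mb => //; exact: powR_ge0.
  + by rewrite f1 g1 !lte_fin ltr01 !ltry.
  + by move=> x y; exact: box_prekopa_leindler.
  + rewrite f1 g1 !poweR_EFin !powR1 mul1e mule1.
    rewrite -[lebesgue_integral h]/(lint setT h) lint_box ?powR_ge0//; last first.
      by rewrite addr_ge0// mulr_ge0// ltW.
    by rewrite lee_fin; apply: (@box_mass_le R lam m t).
- by right; split; exact: log_concave_box.
- move=> a x0 ht a0 lht K.
  have [ht0 _] := lht.
  have [H|Hf] := leP (K%:E * lebesgue_integral f)%E
    (lebesgue_integral (fun x => `|f x - a `^ (- m) * ht (x + m * x0)|)); first by constructor 1.
  have [H|Hg] := leP (K%:E * lebesgue_integral g)%E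
    (lebesgue_integral (fun x => `|g x - a `^ lam * ht (x - lam * x0)|)); first by constructor 2.
  exfalso; rewrite f1 g1 !mule1 in Hf Hg.
  (* In terms of [u], the approximant of [g] is [a * u (x - x0)], since [a * a^(-m) = a^lam] and
     [m x0 - x0 = - lam x0]. This is the form required by [box_far]. *)
  pose u x := a `^ (- m) * ht (x + m * x0).
  have qu : quasi_concave u.
    apply: log_concave_quasi; apply: log_concaveZ; first exact: powR_ge0.
    split=> // x y r r01; have := lht.2 (x + m * x0) (y + m * x0) r r01.
    by congr (_ <= ht _); ring.
  apply: (@box_far R s a x0 K u) => //.
  + by rewrite mulr_ge0// ltW.
  + by rewrite /K; lra.
  + by move=> x; rewrite mulr_ge0 ?powR_ge0.
  + move: Hg; rewrite -[lebesgue_integral _]/(lint setT _).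
    rewrite (@eq_lint _ _ _ (fun x => `|box (1 + s)^-1 (1 + s) x - a * u (x - x0)|))//.
    move=> x _; congr (`|_ - _|); rewrite /u mulrA.
    have -> : a * a `^ (- m) = a `^ lam.
      rewrite -{1}(powRr1 (ltW a0)) -powRD ?(gt_eqF a0) ?implybT//.
      by congr (_ `^ _); rewrite /m; ring.
    by congr (_ * ht _); rewrite /m; ring.
Qed.

(* The weights and shifts below are those of the equality case: if
   f = a^(-(1 - lam)) ht(. + (1 - lam) x0) and g = a^lam ht(. - lam x0), then
   f(x)^lam g(y)^(1 - lam) is free of a, and lam x + (1 - lam) y is unaffected
   by the shifts. *)
Theorem theorem2 (R : realType) :
  exists C c : R, [/\ 0 < c, c < C,
    (forall (lam eps : R) (f g h : R -> R),
      0 < lam < 1 -> 0 < eps ->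
      prekopa_leindler_near_equality lam eps f g h ->
      log_concave h \/ (log_concave f /\ log_concave g) ->
      exists (a x0 : R) (ht : R -> R),
        [/\ 0 < a, log_concave ht &
          let K := C * Num.sqrt (eps / Num.min lam (1 - lam)) in
          [/\ (lebesgue_integral (fun x =>
                 `|f x - a `^ (- (1 - lam)) * ht (x + (1 - lam) * x0)|)%R
               <= K%:E * lebesgue_integral f)%E,
              (lebesgue_integral (fun x =>
                 `|g x - a `^ lam * ht (x - lam * x0)|)%R
               <= K%:E * lebesgue_integral g)%E
            & (lebesgue_integral (fun x => `|h x - ht x|)%R
               <= K%:E * lebesgue_integral h)%E]])
  & (forall lam eps : R,
      0 < lam < 1 -> 0 < eps <= Num.min lam (1 - lam) ->
      exists f g h : R -> R,
        [/\ prekopa_leindler_near_equality lam eps f g h,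
            log_concave h \/ (log_concave f /\ log_concave g) &
          forall (a x0 : R) (ht : R -> R), 0 < a -> log_concave ht ->
            let K := c * Num.sqrt (eps / Num.min lam (1 - lam)) in
            [\/ (K%:E * lebesgue_integral f <=
                 lebesgue_integral (fun x =>
                   `|f x - a `^ (- (1 - lam)) * ht (x + (1 - lam) * x0)|)%R)%E,
                (K%:E * lebesgue_integral g <=
                 lebesgue_integral (fun x =>
                   `|g x - a `^ lam * ht (x - lam * x0)|)%R)%E
              | (K%:E * lebesgue_integral h <=
                 lebesgue_integral (fun x => `|h x - ht x|)%R)%E]])].
Proof.
exists 100, (1 / 10); split; [lra|lra| |].
- exact: prekopa_leindler_stability.
- exact: prekopa_leindler_stability_sharp.
Qed.
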